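(* Let $q\ge 1$, $p=q+1$, let $\alpha_1,\dots,\alpha_{q+1}\in\mathbb{C}$ and $\beta_1,\dots,\beta_q\in\mathbb{C}$ with $\mathrm{Re}\,\beta_j>1$ for all $j$, and let $t\in\mathbb{R}$, $|t|<1$. Then the generalized hypergeometric function $F(t)={}_{q+1}F_q(\alpha_1,\dots,\alpha_{q+1};\beta_1,\dots,\beta_q;t)$ has the representation $$F(t)=C\int \mathrm{d}^q\tau\ \prod_{i=1}^{q}(1-\tau_i)^{\beta_i-2}\ \mathrm{Res}\ \prod_{j=1}^{q+1}(1-a_j\eta)^{-\alpha_j}\,\frac{\mathrm{d}^{q+1}\ln a}{\mathrm{d}\ln(a_1\cdots a_{q+1})},$$ where $$\eta=(\tau_1\cdots\tau_q t)^{\frac1{q+1}},\qquad C=\prod_{i=1}^q(\beta_i-1),$$ and the integral $\int\mathrm{d}^q\tau$ runs over the hypercube $\{0<\tau_i<1:\ i=1,\dots,q\}$.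
   Context: The generalized hypergeometric series is $${}_pF_q(\alpha_1,\dots,\alpha_p;\beta_1,\dots,\beta_q;t)=\sum_{n\ge0}\frac{(\alpha_1)_n\cdots(\alpha_p)_n}{(\beta_1)_n\cdots(\beta_q)_n}\frac{t^n}{n!},$$ with $(\alpha)_0=1$, $(\alpha)_n=\alpha(\alpha+1)\cdots(\alpha+n-1)$. Residuum: $\mathrm{Res}$ of a holomorphic $q$-form $\omega$ near the torus below means $\left(\frac{1}{2\pi \mathrm{i}}\right)^q\int\omega$ over the fundamental $q$-dimensional cycle $\{|a_1|=\dots=|a_{q+1}|=1\}$ of the hypersurface $\{a_1\cdots a_{q+1}=1\}\simeq(\mathbb{C}^* )^q$. Here $\mathrm{d}^{q+1}\ln a=\frac{\mathrm{d}a_1}{a_1}\wedge\cdots\wedge\frac{\mathrm{d}a_{q+1}}{a_{q+1}}$, and $\mathrm{d}^{q+1}\ln a/\mathrm{d}\ln(a_1\cdots a_{q+1})$ is the Gelfand--Leray form, i.e. the $q$-form $\theta$ on the hypersurface with $\theta\wedge \mathrm{d}\ln(a_1\cdots a_{q+1})=\mathrm{d}^{q+1}\ln a$; in the coordinates $a_1,\dots,a_q$ on the hypersurface it is $\frac{\mathrm{d}a_1}{a_1}\wedge\cdots\wedge\frac{\mathrm{d}a_q}{a_q}$, and the cycle is oriented so that $\mathrm{Res}$ of this form equals $1$. The powers $(1-a_j\eta)^{-\alpha_j}$ are principal branches (equal to $1$ at $\eta=0$), and $\eta=(\tau_1\cdots\tau_q)^{1/(q+1)}t^{1/(q+1)}$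 with the positive root of $\tau_1\cdots\tau_q$ and any fixed choice of $t^{1/(q+1)}$. *)

(* Defs.v *)
From HB Require Import structures.
From mathcomp Require Import all_boot all_order all_algebra.
From mathcomp Require Import all_classical all_reals all_analysis.
From mathcomp Require Import complex.
Import Order.TTheory GRing.Theory Num.Theory.
Import numFieldNormedType.Exports.

Set Implicit Arguments.
Unset Strict Implicit.
Unset Printing Implicit Defensive.

Local Open Scope classical_set_scope.
Local Open Scope ring_scope.
Local Open Scope complex_scope.

Local Notation Re := complex.Re.
Local Notation Im := complex.Im.

Section complex_functions.
Context {R : realType}.
Implicit Types (x : R) (z w : R[i]).

Definition cis x : R[i] := cos x +i* sin x.

Definition cexp z : R[i] := (expR (Re z))%:C * cis (Im z).

(* Principal argument, in ]-pi, pi] for z != 0. *)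
Definition carg z : R :=
  let y := acos (Re z / Normc.normc z) in if 0 <= Im z then y else - y.

Definition clog z : R[i] := ln (Normc.normc z) +i* carg z.

(* Principal branch; only meaningful for z != 0. *)
Definition cpow z w : R[i] := cexp (w * clog z).

Definition cderive (f : R -> R[i]) x : R[i] :=
  derive1 (fun u => Re (f u)) x +i* derive1 (fun u => Im (f u)) x.

End complex_functions.

Section hypergeometric.
Context {R : realType}.

Definition pochhammer (a : R[i]) (n : nat) : R[i] := \prod_(i < n) (a + i%:R).

Definition pFq_term (a b : seq R[i]) (t : R[i]) (n : nat) : R[i] :=
  (\prod_(x <- a) pochhammer x n) / (\prod_(y <- b) pochhammer y n)
  * (t ^+ n / n`!%:R).

(* The cast to [numFieldType] selects the norm topology of R[i]. *)
Definition pFq_series (a b : seq R[i]) (t : R[i]) : nat -> (R[i] : numFieldType) :=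
  series (pFq_term a b t : nat -> (R[i] : numFieldType)).

Definition pFq (a b : seq R[i]) (t : R[i]) : R[i] := limn (pFq_series a b t).

End hypergeometric.

Section tuple_lebesgue.
Context {R : realType}.
Local Open Scope ereal_scope.
Local Notation RT n := (n.-tuple (measurableTypeR R)).

Definition tcons n (p : measurableTypeR R * RT n) : RT n.+1 :=
  [tuple of p.1 :: p.2].

Lemma measurable_tcons n : measurable_fun setT (@tcons n).
Proof. exact: (measurable_cons measurable_fst measurable_snd). Qed.

Section cons_measure.
Variables (n : nat) (mu : {sigma_finite_measure set (RT n) -> \bar R}).

Definition cons_measure : set (RT n.+1) -> \bar R :=
  pushforward (lebesgue_measure \x mu) (@tcons n).

Let cons_measure0 : cons_measure set0 = 0.
Proof. by rewrite /cons_measure /pushforward preimage_set0 measure0. Qed.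

Let cons_measure_ge0 A : 0 <= cons_measure A.
Proof. exact: (measure_ge0 (lebesgue_measure \x mu)). Qed.

Let cons_measure_sigma_additive : semi_sigma_additive cons_measure.
Proof.
move=> F mF tF mUF; rewrite /cons_measure /pushforward preimage_bigcup.
have mcons A : measurable A -> measurable (@tcons n @^-1` A).
  by move=> mA; rewrite -[X in measurable X]setTI; exact: measurable_tcons.
apply: (measure_semi_sigma_additive (s := (lebesgue_measure \x mu)%E)).
- by move=> k; exact: mcons.
- apply/trivIsetP => i j _ _ ij; rewrite -preimage_setI.
  by move/trivIsetP : tF => /(_ _ _ _ _ ij) ->//; rewrite preimage_set0.
- by rewrite -preimage_bigcup; exact: mcons.
Qed.

HB.instance Definition _ := isMeasure.Build _ _ _ cons_measure
  cons_measure0 cons_measure_ge0 cons_measure_sigma_additive.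

Let cons_measure_sigma_finite : sigma_finite setT cons_measure.
Proof.
have /sigma_finiteP[F [TF ndF Foo]] :=
  sigma_finiteT (lebesgue_measure : {sigma_finite_measure set (measurableTypeR R) -> \bar R}%R).
have /sigma_finiteP[G [TG ndG Goo]] := sigma_finiteT mu.
pose u (v : RT n.+1) : measurableTypeR R * RT n := (thead v, [tuple of behead v]).
have mu_ : measurable_fun setT u.
  exact: (measurable_fun_pair (measurable_tnth _) (@measurable_behead _ _ _)).
have uK p : u (tcons p) = p.
  by case: p => x v; rewrite /u theadE; congr pair; exact/val_inj.
exists (fun k => u @^-1` (F k `*` G k)).
  apply/seteqP; split => // v _.
  have : [set: measurableTypeR R] (u v).1 by [].
  have : [set: RT n] (u v).2 by [].
  rewrite TF TG => -[l _ Gl] [k _ Fk]; exists (maxn k l) => //; split.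
  - by move: Fk; exact/subsetPset/ndF/leq_maxl.
  - by move: Gl; exact/subsetPset/ndG/leq_maxr.
move=> k; have [mF Fk] := Foo k; have [mG Gk] := Goo k.
split; first by rewrite -[X in measurable X]setTI; apply: mu_ => //; exact: measurableX.
rewrite /cons_measure /pushforward -comp_preimage.
rewrite (_ : u \o _ = id) ?preimage_id; last exact/funext/uK.
by rewrite product_measure1E// lte_mul_pinfty// ge0_fin_numE.
Qed.

HB.instance Definition _ := Measure_isSigmaFinite.Build _ _ _ cons_measure
  cons_measure_sigma_finite.

End cons_measure.

(* n-dimensional (Borel) Lebesgue measure; characterized by [lebesgue_tuple_box]. *)
Fixpoint lebesgue_tuple n : {sigma_finite_measure set (RT n) -> \bar R} :=
  match n with
  | 0%N => \d_ ([tuple] : RT 0)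
  | m.+1 => cons_measure (lebesgue_tuple m)
  end.

Lemma measurable_box n (A : 'I_n -> set (measurableTypeR R)) :
  (forall i, measurable (A i)) ->
  measurable [set x : RT n | forall i, A i (tnth x i)].
Proof.
move=> mA.
rewrite (_ : [set x | _] = \bigcap_(i in [set: 'I_n]) ((@tnth _ _)^~ i @^-1` A i)).
  apply: fin_bigcap_measurable => [|i _]; first exact: finite_finset.
  by rewrite -[X in measurable X]setTI; exact: measurable_tnth.
by apply/seteqP; split => x /= h i => [_|]; exact: h.
Qed.

Lemma lebesgue_tuple_box n (A : 'I_n -> set (measurableTypeR R)) :
  (forall i, measurable (A i)) ->
  lebesgue_tuple n [set x | forall i, A i (tnth x i)] =
  \prod_(i < n) lebesgue_measure (A i).
Proof.
elim: n A => [|n IH] A mA.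
  rewrite big_ord0 /= diracE mem_set// => -[]//.
rewrite big_ord_recl -IH// /= /cons_measure /pushforward.
rewrite (_ : _ @^-1` _ = A ord0 `*` [set x | forall i, A (lift ord0 i) (tnth x i)]).
  by rewrite product_measure1E//; apply: (measurable_box (A := A \o lift ord0)) => i; exact: mA.
apply/seteqP; split => [[x v] /= h|[x v] /= [h1 h2] i].
- by split => [|i]; [exact: (h ord0)|move: (h (lift ord0 i)); rewrite tnthS].
- by case: (unliftP ord0 i) => [j ->|->]; [rewrite tnthS|].
Qed.
End tuple_lebesgue.

Section complex_integral.
Context {d : measure_display} {T : measurableType d} {R : realType}.
Variables (mu : {measure set T -> \bar R}) (D : set T) (f : T -> R[i]).

Definition cintegrable : Prop :=
  mu.-integrable D (fun x => (Re (f x))%:E) /\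
  mu.-integrable D (fun x => (Im (f x))%:E).

Definition cintegral : R[i] :=
  (\int[mu]_(x in D) Re (f x)) +i* (\int[mu]_(x in D) Im (f x)).

End complex_integral.

Section residue.
Context {R : realType} {q : nat}.
Local Notation point := 'rV[R[i]]_(q + 1).

(* A q-form is given by its values at a point a on q vectors, which are the
   rows of V. *)
Local Notation qform := (point -> 'M[R[i]]_(q, q + 1) -> R[i]).

(* d ln (a_1 ... a_(q+1)), evaluated on the vector w *)
Definition dln_prod (a w : point) : R[i] := \sum_j w 0 j / a 0 j.

(* d a_1/a_1 /\ ... /\ d a_(q+1)/a_(q+1), evaluated on the rows of W *)
Definition dln_vol (a : point) (W : 'M[R[i]]_(q + 1)) : R[i] :=
  \det (\matrix_(k, j) (W k j / a 0 j)).

(* d a_1/a_1 /\ ... /\ d a_q/a_q, evaluated on the rows of V *)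
Definition gelfand_leray : qform := fun a V =>
  \det (\matrix_(k, j) (V k (lshift 1 j) / a 0 (lshift 1 j))).

(* The defining property theta /\ d ln (a_1 ... a_(q+1)) = d^(q+1) ln a of the
   Gelfand-Leray form: as d ln (a_1 ... a_(q+1)) vanishes on the vectors tangent
   to the hypersurface, the wedge product on (V, w), V tangent, is the left-hand
   side below. *)
Lemma gelfand_lerayP (a : point) (V : 'M[R[i]]_(q, q + 1)) (w : point) :
  (forall k, dln_prod a (row k V) = 0) ->
  gelfand_leray a V * dln_prod a w = dln_vol a (col_mx V w).
Proof.
move=> tV.
pose U : 'M[R[i]]_(q + 1) := block_mx 1%:M (const_mx 1) 0 1%:M.
have dU : \det U = 1 by rewrite det_ublock !det1 mulr1.
rewrite /dln_vol -[RHS]mulr1 -dU -det_mulmx.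
pose L : 'M[R[i]]_(q + 1) :=
  block_mx (\matrix_(k, j) (V k (lshift 1 j) / a 0 (lshift 1 j))) 0
           (\row_j (w 0 (lshift 1 j) / a 0 (lshift 1 j))) (dln_prod a w)%:M.
suff -> : (\matrix_(k, j) (col_mx V w k j / a 0 j)) *m U = L.
  by rewrite det_lblock det_scalar1.
set M := (X in X *m _).
rewrite /L /U.
have Mu k j : M (lshift 1 k) j = V k j / a 0 j by rewrite mxE col_mxEu.
have Md k j : M (rshift q k) j = w 0 j / a 0 j by rewrite mxE col_mxEd ord1.
rewrite -[M]submxK mulmx_block !(mulmx1, mulmx0, addr0); congr block_mx.
- by apply/matrixP => k j; rewrite [RHS]mxE -Mu !mxE.
- apply/matrixP => k j; rewrite [RHS]mxE -[RHS](tV k) /dln_prod big_split_ord/= big_ord1.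
  rewrite mxE mxE; congr +%R; last by rewrite [LHS]mxE [LHS]mxE Mu mxE ord1.
  by apply: eq_bigr => i _; rewrite [X in _ * X]mxE mulr1 [LHS]mxE [LHS]mxE Mu mxE.
- by apply/rowP => j; rewrite [LHS]mxE [LHS]mxE Md mxE.
- apply/matrixP => k j; rewrite [RHS]mxE !ord1 eqxx mulr1n /dln_prod big_split_ord/= big_ord1.
  rewrite mxE mxE; congr +%R; last by rewrite [LHS]mxE [LHS]mxE Md.
  by apply: eq_bigr => i _; rewrite [X in _ * X]mxE mulr1 [LHS]mxE [LHS]mxE Md.
Qed.

(* The cycle |a_1| = ... = |a_(q+1)| = 1 of a_1 ... a_(q+1) = 1, parametrized by
   the arguments of a_1, ..., a_q. *)
Definition torus (x : q.-tuple R) : point :=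
  row_mx (\row_k cis (tnth x k)) (const_mx (\prod_k cis (tnth x k))^-1).

(* Row k is the partial derivative of [torus] in its k-th argument. *)
Definition torus_jac (x : q.-tuple R) : 'M[R[i]]_(q, q + 1) :=
  \matrix_(k, j) cderive
    (fun u => torus [tuple (if l == k then u else tnth x l) | l < q] 0 j)
    (tnth x k).

Definition pullback (omega : qform) (x : q.-tuple (measurableTypeR R)) : R[i] :=
  omega (torus x) (torus_jac x).

Definition angles : set (q.-tuple (measurableTypeR R)) :=
  [set x | forall k, 0 <= tnth x k <= 2 * pi].

Definition Res_exists (omega : qform) : Prop :=
  cintegrable (lebesgue_tuple q) angles (pullback omega).

Definition Res (omega : qform) : R[i] :=
  ((2 * pi)%:C * 'i)^-1 ^+ q * cintegral (lebesgue_tuple q) angles (pullback omega).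

Lemma pullback_gelfand_leray (x : q.-tuple R) :
  pullback gelfand_leray x = 'i ^+ q.
Proof.
rewrite /pullback /gelfand_leray.
rewrite (_ : \matrix_(k, j) _ = 'i%:M) ?det_scalar//.
apply/matrixP => k j; rewrite [LHS]mxE [in RHS]mxE [X in X / _]mxE.
rewrite /torus row_mxEl mxE.
rewrite (_ : (fun u => _) = fun u => cis (if j == k then u else tnth x j)); last first.
  by apply/funext => u; rewrite row_mxEl !mxE tnth_mktuple.
rewrite eq_sym /cderive; case: eqVneq => [->|_] /=; last first.
  by rewrite !derive1_cst mulr0n mul0r.
rewrite mulr1n !derive1E !derive_val /=.
have cis_neq0 : cis (tnth x j) != 0.
  by rewrite eq_complex /= -sqrf_eq0 -[X in _ && X]sqrf_eq0 -paddr_eq0 ?sqr_ge0// cos2Dsin2 oner_eq0.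
apply: (mulIf cis_neq0); rewrite divfK// /cis; apply/eqP.
by rewrite eq_complex /= !(mul0r, mul1r, add0r, addr0, sub0r) !eqxx.
Qed.

Lemma measurable_angles : measurable angles.
Proof.
apply: (measurable_box (A := fun=> [set u | 0 <= u <= 2 * pi])) => _.
rewrite (_ : [set u | _] = `[0, 2 * pi]%classic); first exact: measurable_itv.
by apply/seteqP; split => u /=; rewrite in_itv.
Qed.

Lemma lebesgue_angles : lebesgue_tuple q angles = ((2 * pi) ^+ q)%:E.
Proof.
pose I : set R := `[0, 2 * pi]%classic.
rewrite (_ : angles = [set x | forall k, I (tnth x k)]); last first.
  by apply/seteqP; split => x /= h k; move: (h k); rewrite /I /= in_itv.
rewrite (@lebesgue_tuple_box R q (fun=> I))//; last by move=> _; exact: measurable_itv.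
rewrite (eq_bigr (fun=> (2 * pi)%:E))/=; last first.
  move=> i _; rewrite /I lebesgue_measure_itv/= lte_fin mulr_gt0// ?pi_gt0//.
  by rewrite sube0.
by rewrite prodEFin big_const_ord iter_mulr_1.
Qed.

(* The orientation of the cycle is the one for which this holds. *)
Lemma Res_gelfand_leray : Res gelfand_leray = 1.
Proof.
rewrite /Res /cintegral.
under eq_Rintegral do rewrite pullback_gelfand_leray.
under [X in _ +i* X]eq_Rintegral do rewrite pullback_gelfand_leray.
rewrite !Rintegral_cst; [|exact: measurable_angles..].
have -> : fine (lebesgue_tuple q angles) = (2 * pi) ^+ q by rewrite lebesgue_angles.
rewrite (_ : _ +i* _ = ((2 * pi)%:C * 'i) ^+ q); last first.
  rewrite [RHS]exprMn -(rmorphXn (real_complex R)); move: (_ ^+ q) ('i ^+ q) => r [u v].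
  by apply/eqP; rewrite eq_complex /= !mul0r subr0 addr0 !(mulrC r) !eqxx.
rewrite -exprMn mulVf ?expr1n// mulf_neq0//.
  by rewrite eq_complex/= eqxx andbT mulf_neq0// gt_eqF ?pi_gt0.
by rewrite eq_complex/= oner_eq0 andbF.
Qed.

End residue.

Definition cube {R : realType} {q : nat} : set (q.-tuple (measurableTypeR R)) :=
  [set x | forall i, 0 < tnth x i < 1].

(* Main.v *)
(* Replace each factor (1 - a_j eta)^(-alpha_j) by the partial sum of its binomial
   series. The residue of the resulting Laurent polynomial on
   {a_1 ... a_(q+1) = 1} only retains the monomials (a_1 ... a_(q+1))^n, so it is
   the sum of prod_j (alpha_j)_n / n! * eta^(n (q+1)), where eta^(q+1) is
   tau_1 ... tau_q t. On the hypercube the integral then splits into Beta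
   integrals
     int_0^1 (1 - u)^(beta - 2) u^n du = n! / ((beta - 1) (beta)_n),
   which gives the partial sums of the hypergeometric series. As the partial sums
   are bounded uniformly for |eta| <= |t|^(1/(q+1)) < 1, dominated convergence,
   on the torus and on the hypercube, yields both the convergence of the series
   and the formula. *)

Require Import Defs.
From mathcomp Require Import all_boot all_order all_algebra.
From mathcomp Require Import all_classical all_reals all_analysis.
From mathcomp Require Import measurable_realfun complex.
From mathcomp Require Import ring lra.
Import Order.TTheory GRing.Theory Num.Theory.
Import numFieldNormedType.Exports.
Local Open Scope classical_set_scope.
Local Open Scope ring_scope.
Local Open Scope complex_scope.

Set Implicit Arguments.
Unset Strict Implicit.
Unset Printing Implicit Defensive.

(** Everything rests on one uniform estimate: on a disc |z| <= r < 1 the partial sums of the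
    binomial series approach the principal power uniformly. It is proved by real analysis along the
    segment from 0 to z, through a differential equation. The truncated products on the torus are
    therefore bounded uniformly in the order, in eta and in the angles. The diagonal sums are
    averages of these products, so they inherit the bound without any growth estimate on their
    coefficients. The weight (1 - u)^(beta - 2) is singular at u = 1 when Re beta < 2. The Beta
    integrals are thus reached as limits of integrals over [0, b] with b < 1. The condition Re beta
    > 1 serves twice there: it makes the weight integrable, and it makes the boundary term at 1
    vanish. The fractional power in eta causes no trouble, since the surviving monomials involve eta
    only through eta^(q+1); this is also why any root of t may be fixed. *)

Section complex_numbers.
Context {R : realType}.
Implicit Types z w : R[i].

(** * Algebra of complex numbers, modulus and exponential *)

Lemma ReM z w : complex.Re (z * w) =
  complex.Re z * complex.Re w - complex.Im z * complex.Im w.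
Proof. by case: z w => [a b] [c d]. Qed.

Lemma ImM z w : complex.Im (z * w) =
  complex.Re z * complex.Im w + complex.Im z * complex.Re w.
Proof. by case: z w => [a b] [c d]. Qed.

Lemma ReD z w : complex.Re (z + w) = complex.Re z + complex.Re w.
Proof. by case: z w => [a b] [c d]. Qed.

Lemma ImD z w : complex.Im (z + w) = complex.Im z + complex.Im w.
Proof. by case: z w => [a b] [c d]. Qed.

Lemma normcX z n : Normc.normc (z ^+ n) = Normc.normc z ^+ n.
Proof.
elim: n => [|n IH]; first by rewrite !expr0 Normc.normc1.
by rewrite !exprS Normc.normcM IH.
Qed.

Lemma normc_ge0 z : 0 <= Normc.normc z.
Proof. by case: z => a b; exact: sqrtr_ge0. Qed.

Lemma normc_prod I (r : seq I) (P : pred I) (F : I -> R[i]) :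
  Normc.normc (\prod_(i <- r | P i) F i) = \prod_(i <- r | P i) Normc.normc (F i).
Proof. by apply: big_morph; [exact: Normc.normcM|exact: Normc.normc1]. Qed.

Lemma normc_real (x : R) : Normc.normc x%:C = `|x|.
Proof. by rewrite /Normc.normc /= expr0n addr0 sqrtr_sqr. Qed.

Lemma normc_nat n : Normc.normc (n%:R : R[i]) = n%:R.
Proof. by rewrite -(rmorph_nat (real_complex R)) normc_real normr_nat. Qed.

Lemma normc_sqr z : Normc.normc z ^+ 2 = complex.Re z ^+ 2 + complex.Im z ^+ 2.
Proof. by case: z => a b; rewrite sqr_sqrtr// addr_ge0 ?sqr_ge0. Qed.

Lemma normc_Re z : `|complex.Re z| <= Normc.normc z.
Proof.
by case: z => a b /=; rewrite -sqrtr_sqr ler_wsqrtr// lerDl sqr_ge0.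
Qed.

Lemma normc_Im z : `|complex.Im z| <= Normc.normc z.
Proof.
by case: z => a b /=; rewrite -sqrtr_sqr ler_wsqrtr// lerDr sqr_ge0.
Qed.

Lemma normc_le_ReIm z : Normc.normc z <= `|complex.Re z| + `|complex.Im z|.
Proof.
case: z => a b /=.
rewrite -ler_sqr ?nnegrE ?sqrtr_ge0 ?addr_ge0// sqr_sqrtr ?addr_ge0 ?sqr_ge0//.
by rewrite sqrrD !real_normK ?num_real// addrAC lerDl mulrn_wge0// mulr_ge0.
Qed.

Lemma normc_cis (x : R) : Normc.normc (cis x) = 1.
Proof. by rewrite /cis /= cos2Dsin2 sqrtr1. Qed.

Lemma cisD (x y : R) : cis (x + y) = cis x * cis y.
Proof.
rewrite /cis; apply/eqP; rewrite eq_complex ReM ImM /= cosD sinD.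
by rewrite eqxx /= addrC eqxx.
Qed.

Lemma cis0 : cis (0 : R) = 1.
Proof. by rewrite /cis cos0 sin0. Qed.

Lemma cisMn (x : R) n : cis (x *+ n) = cis x ^+ n.
Proof.
elim: n => [|n IH]; first by rewrite mulr0n cis0.
by rewrite mulrS cisD IH exprS.
Qed.

Lemma cisN (x : R) : cis (- x) = (cis x)^-1.
Proof.
have h : cis x * cis (- x) = 1 by rewrite -cisD subrr cis0.
have c0 : cis x != 0.
  by apply: contra_eq_neq h => ->; rewrite mul0r eq_sym oner_neq0.
by rewrite -[RHS]mulr1 -h mulKf.
Qed.

Lemma cexpD z w : cexp (z + w) = cexp z * cexp w.
Proof.
by rewrite /cexp ReD ImD expRD cisD rmorphM mulrACA.
Qed.

Lemma normc_cexp z : Normc.normc (cexp z) = expR (complex.Re z).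
Proof. by rewrite Normc.normcM normc_cis mulr1 normc_real ger0_norm// expR_ge0. Qed.

Lemma cexp0 : cexp (0 : R[i]) = 1.
Proof. by rewrite /cexp /= expR0 cis0 mulr1. Qed.

End complex_numbers.

(* On the right half-plane the argument is an arctangent, which is easier to
   differentiate than the arccosine in [carg]. *)
Section right_half_plane.
Context {R : realType}.
Implicit Types z w : R[i].

Definition clog_rhp z : R[i] :=
  (ln (complex.Re z ^+ 2 + complex.Im z ^+ 2) / 2)
  +i* atan (complex.Im z / complex.Re z).

Definition cpow_rhp z w : R[i] := cexp (w * clog_rhp z).

Lemma cos_atan_rhp z : 0 < complex.Re z ->
  cos (atan (complex.Im z / complex.Re z)) = complex.Re z / Normc.normc z.
Proof.
case: z => x y /= x0; rewrite cos_atan.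
have -> : 1 + (y / x) ^+ 2 = (x ^+ 2 + y ^+ 2) / x ^+ 2.
  by field; rewrite gt_eqF.
rewrite sqrtrM ?addr_ge0 ?sqr_ge0// sqrtrV ?sqr_ge0// sqrtr_sqr gtr0_norm//.
by rewrite invfM invrK mulrC.
Qed.

Lemma ln_normc z : 0 < complex.Re z ->
  ln (Normc.normc z) = ln (complex.Re z ^+ 2 + complex.Im z ^+ 2) / 2.
Proof.
move=> x0; have n0 : 0 < Normc.normc z.
  by rewrite (lt_le_trans x0)// (le_trans (ler_norm _))// normc_Re.
by rewrite -normc_sqr lnXn// -(mulr_natr (ln _)) mulfK.
Qed.

Lemma clog_rhpE z : 0 < complex.Re z -> clog z = clog_rhp z.
Proof.
move=> x0; rewrite /clog /clog_rhp ln_normc//; congr (_ +i* _).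
rewrite /carg -cos_atan_rhp//; set a := atan _.
have api2 : a < pi / 2 := atan_ltpi2 _.
have aNpi2 : - (pi / 2) < a := atan_gtNpi2 _.
have pi0 : 0 < pi :> R := pi_gt0 _.
(* [acos] inverts [cos] only on [0, pi]. For a negative imaginary part it returns [- a], which the
   second branch of [carg] negates back. *)
case: ifPn => y0.
  rewrite cosK// in_itv /=; apply/andP; split; last by lra.
  by rewrite -atan0 le_atan// divr_ge0// ltW.
rewrite cosKN ?opprK//; apply/andP; split; first by lra.
by rewrite -atan0 le_atan// mulr_le0_ge0 ?invr_ge0 ?(ltW x0)// ltW// ltNge.
Qed.

Lemma cpow_rhpE z w : 0 < complex.Re z -> cpow z w = cpow_rhp z w.
Proof. by move=> x0; rewrite /cpow clog_rhpE. Qed.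

Lemma cexp_clog_rhp z : 0 < complex.Re z -> cexp (clog_rhp z) = z.
Proof.
move=> x0; have n0 : 0 < Normc.normc z.
  by rewrite (lt_le_trans x0)// (le_trans (ler_norm _))// normc_Re.
rewrite /cexp /= -ln_normc// lnK//.
have ca := cos_atan_rhp x0.
have sa : sin (atan (complex.Im z / complex.Re z)) = complex.Im z / Normc.normc z.
  have := atanK (complex.Im z / complex.Re z); rewrite /tan ca => h.
  rewrite -[LHS](divfK (x := complex.Re z / Normc.normc z)) ?h.
    by field; rewrite !gt_eqF.
  by rewrite gt_eqF// divr_gt0.
rewrite /cis ca sa; case: (z) n0 => x y /= n0.
by apply/eqP; rewrite eq_complex /= !mul0r subr0 addr0 !(mulrC (Num.sqrt _)) !divfK ?eqxx ?gt_eqF.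
Qed.

Lemma cpow_rhpD z w1 w2 : cpow_rhp z (w1 + w2) = cpow_rhp z w1 * cpow_rhp z w2.
Proof. by rewrite /cpow_rhp mulrDl cexpD. Qed.

Lemma cpow_rhp1 z : 0 < complex.Re z -> cpow_rhp z 1 = z.
Proof. by move=> x0; rewrite /cpow_rhp mul1r cexp_clog_rhp. Qed.

Lemma cpow_rhp0 z : cpow_rhp z 0 = 1.
Proof. by rewrite /cpow_rhp mul0r cexp0. Qed.

Lemma clog_rhp_real (x : R) : 0 < x -> clog_rhp x%:C = (ln x)%:C.
Proof.
by move=> x0; rewrite /clog_rhp /= mul0r atan0 expr0n addr0 lnXn// -(mulr_natr (ln _)) mulfK.
Qed.

Lemma cpow_rhp_1 w : cpow_rhp 1 w = 1.
Proof. by rewrite /cpow_rhp clog_rhp_real// ln1 mulr0 cexp0. Qed.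

Lemma normc_cpow_rhp_real (x : R) w : 0 < x ->
  Normc.normc (cpow_rhp x%:C w) = x `^ complex.Re w.
Proof.
move=> x0; rewrite normc_cexp clog_rhp_real// ReM /= mulr0 subr0.
by rewrite /powR gt_eqF.
Qed.

End right_half_plane.

(** * Complex-valued functions of a real variable *)

Section complex_derivative.
Context {R : realType}.
Implicit Types (f g : R -> R[i]) (x : R) (a b l z w : R[i]).

(** Every function differentiated below has a real argument (a point of a segment, an angle, a Beta
    variable), so two real derivatives suffice. *)
Definition is_cderive f x l :=
  is_derive x 1 (fun u => complex.Re (f u)) (complex.Re l) /\
  is_derive x 1 (fun u => complex.Im (f u)) (complex.Im l).

Lemma is_cderive_eq f x a b : is_cderive f x a -> a = b -> is_cderive f x b.
Proof. by move=> h <-. Qed.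

Lemma is_cderive_cst z x : is_cderive (fun=> z) x 0.
Proof. by split; exact: is_derive_cst. Qed.

Lemma is_cderive_real x : is_cderive (fun u => u%:C) x 1.
Proof. by split; [exact: is_derive_id|exact: is_derive_cst]. Qed.

Lemma is_cderiveD f g x a b : is_cderive f x a -> is_cderive g x b ->
  is_cderive (fun u => f u + g u) x (a + b).
Proof.
move=> [f1 f2] [g1 g2]; split.
- rewrite ReD; under eq_fun do rewrite ReD; exact: is_deriveD.
- rewrite ImD; under eq_fun do rewrite ImD; exact: is_deriveD.
Qed.

Lemma is_cderiveM f g x a b : is_cderive f x a -> is_cderive g x b ->
  is_cderive (fun u => f u * g u) x (a * g x + f x * b).
Proof.
move=> [f1 f2] [g1 g2]; split.
- under eq_fun do rewrite ReM.
  apply: is_derive_eq; rewrite ReD !ReM /GRing.scale /=; ring.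
- under eq_fun do rewrite ImM.
  apply: is_derive_eq; rewrite ImD !ImM /GRing.scale /=; ring.
Qed.

Lemma is_cderive_sum (f_ : nat -> R -> R[i]) (l_ : nat -> R[i]) n x :
  (forall k, is_cderive (f_ k) x (l_ k)) ->
  is_cderive (fun u => \sum_(k < n) f_ k u) x (\sum_(k < n) l_ k).
Proof.
move=> h; elim: n => [|n IH].
  by under eq_fun do rewrite big_ord0; rewrite big_ord0; exact: is_cderive_cst.
under eq_fun do rewrite big_ord_recr /=.
by rewrite big_ord_recr /=; exact: is_cderiveD.
Qed.

Lemma is_cderiveX f x l n : is_cderive f x l ->
  is_cderive (fun u => f u ^+ n) x (n%:R * f x ^+ n.-1 * l).
Proof.
move=> h; elim: n => [|n IH].
  by under eq_fun do rewrite expr0; rewrite !mul0r; exact: is_cderive_cst.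
under eq_fun do rewrite exprS.
apply: is_cderive_eq; first exact: (is_cderiveM h IH).
(* The truncated predecessor [n.-1] is only the true exponent for positive [n], hence the separate
   case. *)
case: n {IH} => [|n]; first by rewrite expr0 !mul0r mulr0 addr0 mulr1 !mul1r.
rewrite -[n.+1.-1]/n -[n.+2.-1]/n.+1 exprS -[n.+2]addn1 natrD; ring.
Qed.

Lemma is_cderive_cexp f x l : is_cderive f x l ->
  is_cderive (fun u => cexp (f u)) x (l * cexp (f x)).
Proof.
move=> [f1 f2]; split; rewrite /cexp /cis.
- under eq_fun do rewrite ReM /= mul0r subr0.
  have d1 := @is_derive1_comp _ expR _ _ _ _ (is_derive_expR _) f1.
  have d2 := @is_derive1_comp _ cos _ _ _ _ (is_derive_cos _) f2.
  apply: (is_derive_eq (is_deriveM d1 d2)).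
  by rewrite /GRing.scale /=; case: l {f1 f2 d1 d2} => p q /=; ring.
- under eq_fun do rewrite ImM /= mul0r addr0.
  have d1 := @is_derive1_comp _ expR _ _ _ _ (is_derive_expR _) f1.
  have d2 := @is_derive1_comp _ sin _ _ _ _ (is_derive_sin _) f2.
  apply: (is_derive_eq (is_deriveM d1 d2)).
  by rewrite /GRing.scale /=; case: l {f1 f2 d1 d2} => p q /=; ring.
Qed.

Lemma is_cderive_clog_rhp f x l : 0 < complex.Re (f x) -> is_cderive f x l ->
  is_cderive (fun u => clog_rhp (f u)) x (l / f x).
Proof.
move=> fx0 [f1 f2]; rewrite /clog_rhp; split => /=.
- have n0 : 0 < complex.Re (f x) ^+ 2 + complex.Im (f x) ^+ 2.
    by rewrite ltr_pwDl ?exprn_gt0 ?sqr_ge0.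
  have d1 := is_deriveX 2 f1.
  have d2 := is_deriveX 2 f2.
  have d := is_deriveD d1 d2.
  have := @is_derive1_comp _ (@ln R) _ _ _ _ (is_derive1_ln _) d.
  move=> /(_ n0) => d3.
  have := is_deriveM d3 (is_derive_cst (2^-1 : R) x 1).
  move=> d4; apply: (is_derive_eq d4).
  rewrite /GRing.scale /= !fctE /=.
  move: (f x) l n0 fx0 {f1 f2 d1 d2 d d3 d4} => [r s] [p q] /= n0 fx0.
  by field; exact: lt0r_neq0.
- have x0 : complex.Re (f x) != 0 by rewrite gt_eqF.
  have d1 : is_derive x 1 (fun u => (complex.Re (f u))^-1)
      (- complex.Re (f x) ^- 2 * complex.Re l).
    split; first by apply: derivableV => //; exact: ex_derive.
    by rewrite deriveV//; congr (_ * _); exact: derive_val.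
  have d := @is_derive1_comp _ atan _ _ _ _ (is_derive1_atan _) (is_deriveM f2 d1).
  apply: (is_derive_eq d).
  rewrite /GRing.scale /= ?fctE /=.
  move: (f x) l x0 fx0 {f1 f2 d1 d} => [r s] [p q] /= x0 fx0.
  field.
  by rewrite x0 /= lt0r_neq0// ltr_pwDl ?exprn_gt0 ?sqr_ge0.
Qed.

Lemma is_cderive_cpow_rhp f x l w : 0 < complex.Re (f x) -> is_cderive f x l ->
  is_cderive (fun u => cpow_rhp (f u) w) x (w * l * cpow_rhp (f x) (w - 1)).
Proof.
move=> fx0 df.
have dl := is_cderive_clog_rhp fx0 df.
apply: is_cderive_eq.
  exact: (is_cderive_cexp (is_cderiveM (is_cderive_cst w x) dl)).
rewrite mul0r add0r -/(cpow_rhp (f x) w) -[X in cpow_rhp _ X](subrK 1).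
rewrite (cpow_rhpD _ _ 1) cpow_rhp1//.
have fx1 : f x != 0 by apply: contraTneq fx0 => ->; rewrite ltxx.
by field.
Qed.

Lemma is_derive_continuous (f : R -> R) x (l : R) :
  is_derive x 1 f l -> {for x, continuous f}.
Proof.
by move=> [fx _]; apply: differentiable_continuous; exact/derivable1_diffP.
Qed.

Lemma mvt_le (f df : R -> R) (a b K : R) : a < b ->
  (forall u, a <= u <= b -> is_derive u 1 f (df u)) ->
  (forall u, a < u < b -> `|df u| <= K) -> `|f b - f a| <= K * (b - a).
Proof.
move=> ab d dK.
have [u|| u] := @MVT _ f df a b ab.
- by rewrite in_itv /= => /andP[au ub]; apply: d; rewrite !ltW.
- apply: derivable_within_continuous => u; rewrite in_itv /= => uab.
  by have [] := d u uab.
- rewrite in_itv /= => uab ->; rewrite normrM [X in _ * X]gtr0_norm ?subr_gt0//.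
  by rewrite ler_pM2r ?subr_gt0//; exact: dK.
Qed.

(** The equality of the mean value theorem fails for complex values. Applying it to both components
    costs the factor 2. *)
Lemma cmvt_le f df (a b K : R) : a < b ->
  (forall u, a <= u <= b -> is_cderive f u (df u)) ->
  (forall u, a < u < b -> Normc.normc (df u) <= K) ->
  Normc.normc (f b - f a) <= 2 * K * (b - a).
Proof.
move=> ab d dK; apply: (le_trans (normc_le_ReIm _)).
rewrite ReD ImD (_ : complex.Re (- f a) = - complex.Re (f a)); last by case: (f a).
rewrite (_ : complex.Im (- f a) = - complex.Im (f a)); last by case: (f a).
rewrite mulr2n !mulrDl !mul1r; apply: lerD.
- apply: (@mvt_le (fun u => complex.Re (f u)) (fun u => complex.Re (df u))) => // u uab.
    by have [] := d u uab.
  by rewrite (le_trans (normc_Re _))// dK.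
- apply: (@mvt_le (fun u => complex.Im (f u)) (fun u => complex.Im (df u))) => // u uab.
    by have [] := d u uab.
  by rewrite (le_trans (normc_Im _))// dK.
Qed.

End complex_derivative.

(** * The binomial series with complex exponent *)

Section binomial_series.
Context {R : realType}.
Implicit Types (al z w : R[i]) (r : R).

Definition binomial_coef al n : R[i] := pochhammer al n / n`!%:R.

Definition binomial_poly al N z : R[i] := \sum_(n < N) binomial_coef al n * z ^+ n.

Lemma binomial_coefS al n :
  n.+1%:R * binomial_coef al n.+1 = (al + n%:R) * binomial_coef al n.
Proof.
rewrite /binomial_coef /pochhammer big_ord_recr /= factS natrM.
by field; rewrite !pnatr_eq0 -lt0n fact_gt0 addrC natr1 pnatr_eq0.
Qed.

(* The partial sums of the binomial series satisfy the differential equation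
   (1 - z) p' = al p up to a term of order N, and that term tends to 0. *)
Lemma binomial_poly_deriv al N z :
  (1 - z) * (\sum_(n < N) binomial_coef al n * (n%:R * z ^+ n.-1)) =
  al * binomial_poly al N z - N%:R * binomial_coef al N * z ^+ N.-1.
Proof.
elim: N => [|N IH].
  by rewrite /binomial_poly !big_ord0 !mul0r !mulr0 subr0.
rewrite /binomial_poly big_ord_recr /= mulrDr IH /binomial_poly big_ord_recr /=.
rewrite binomial_coefS; case: N {IH} => [|N]; first by rewrite !big_ord0; ring.
by rewrite exprS /=; ring.
Qed.

(** This places every base [1 - a_j eta] in the half-plane where [cpow] and [cpow_rhp] agree. *)
Lemma Re_onem_gt0 z : Normc.normc z < 1 -> 0 < complex.Re (1 - z).
Proof.
move=> z1; have := le_lt_trans (normc_Re z) z1.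
by case: z {z1} => x y /=; rewrite ltr_norml => /andP[]; lra.
Qed.

Lemma normc_onem z : 1 - Normc.normc z <= Normc.normc (1 - z) <= 1 + Normc.normc z.
Proof.
apply/andP; split.
  have := le_normcD (1 - z) z.
  by rewrite subrK Normc.normc1; lra.
by have := le_normcD 1 (- z); rewrite Normc.normc1 normcN.
Qed.

(** The modulus is exp(Re w ln|1 - z| - Im w arg(1 - z)). Here ln|1 - z| lies between ln(1 - r) and
    ln 2, both covered by [L], and the argument is at most pi/2 in absolute value. *)
Lemma normc_cpow_rhp_le w r : r < 1 ->
  exists2 K, 0 < K & forall z, Normc.normc z <= r ->
    Normc.normc (cpow_rhp (1 - z) w) <= K.
Proof.
move=> r1; pose L := `|ln (1 - r)| + ln 2.
exists (expR (`|complex.Re w| * L + `|complex.Im w| * (pi / 2))); first exact: expR_gt0.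
move=> z zr; rewrite normc_cexp ler_expR ReM.
have z1 := le_lt_trans zr r1.
have w0 := Re_onem_gt0 z1; have /andP[lo hi] := normc_onem z.
rewrite [complex.Re (clog_rhp _)]/= -ln_normc//.
apply: (le_trans (ler_norm _)); apply: (le_trans (ler_normB _ _)).
rewrite !normrM; apply: lerD; apply: ler_wpM2l => //.
- have n0 : 0 < Normc.normc (1 - z) by rewrite (lt_le_trans _ lo)// subr_gt0.
  rewrite ler_norml; apply/andP; split.
    apply: (@le_trans _ _ (ln (1 - r))).
      have := ler_norm (- ln (1 - r)); rewrite normrN /L.
      have : 0 <= ln (2 : R) by rewrite ln_ge0// ler1n.
      by lra.
    rewrite ler_ln ?posrE ?subr_gt0//; lra.
  apply: (@le_trans _ _ (ln 2)); last by rewrite lerDr.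
  rewrite ler_ln ?posrE//; lra.
- rewrite ler_norml /= (ltW (atan_gtNpi2 _)) /=; exact: (ltW (atan_ltpi2 _)).
Qed.

(** Size of the remainder in [binomial_poly_deriv]: its power of z has exponent N - 1, and the
    missing factor comes from the derivative [z] of u |-> u z. *)
Let err al r n : R := n%:R * Normc.normc (binomial_coef al n) * r ^+ n.

Lemma binomial_err_ratio al r : 0 <= r < 1 ->
  exists N rho, [/\ 0 <= rho < 1 &
    forall n, (N <= n)%N -> err al r n.+1 <= rho * err al r n].
Proof.
move=> /andP[r0 r1]; pose rho := (1 + r) / 2.
have dr : 0 < rho - r by rewrite /rho; lra.
(* From this rank on |al| r <= (rho - r) n, that is (|al| + n) r <= rho n, and |al| + n bounds the
   factor |al + n| of the recurrence. As [rho] any number strictly between r and 1 would do; the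
   midpoint is taken. *)
exists (Num.truncn (Normc.normc al * r / (rho - r))).+1, rho.
split; first by rewrite /rho; apply/andP; split; lra.
move=> n nN; have : Normc.normc al * r / (rho - r) <= n%:R.
  rewrite (le_trans (ltW (truncnS_gt _)))// ler_nat//.
rewrite ler_pdivrMr// => h.
have -> : err al r n.+1 = Normc.normc (al + n%:R) * r * (Normc.normc (binomial_coef al n) * r ^+ n).
  rewrite /err -normc_nat -Normc.normcM binomial_coefS Normc.normcM exprS; ring.
rewrite /err -(mulrA n%:R) [leRHS]mulrA; apply: ler_wpM2r.
  by rewrite mulr_ge0 ?normc_ge0 ?exprn_ge0.
have := le_normcD al n%:R; rewrite normc_nat => /(ler_wpM2r r0) h'.
by apply: (le_trans h'); nra.
Qed.

Lemma binomial_err_cvg0 al r : 0 <= r < 1 -> err al r n @[n --> \oo] --> (0 : R).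
Proof.
move=> r01; have [N [rho [/andP[rho0 rho1] h]]] := binomial_err_ratio al r01.
have e0 n : 0 <= err al r n.
  by case/andP: r01 => r0 _; rewrite /err !mulr_ge0 ?normc_ge0 ?exprn_ge0.
rewrite -(cvg_shiftn N).
have h2 k : err al r (k + N)%N <= err al r N * rho ^+ k.
  elim: k => [|k IH]; first by rewrite expr0 mulr1 add0n.
  rewrite addSn (le_trans (h _ _)) ?leq_addl// exprS [leRHS]mulrCA.
  by apply: ler_wpM2l.
apply: (@squeeze_cvgr _ _ _ _ (fun=> 0) (geometric (err al r N) rho)).
- by apply: nearW => k; rewrite e0 /= h2.
- exact: cvg_cst.
- by apply: cvg_geometric; rewrite ger0_norm.
Qed.

(* The derivative of u |-> (1 - u z)^al p_N(u z) is small on [0, 1], so its value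
   at 1 is close to its value 1 at 0. The index is N.+1 because the latter fails
   for the empty sum. *)
Lemma binomial_series al r : 0 <= r < 1 ->
  exists2 e : nat -> R, e @ \oo --> (0 : R) & forall N z, Normc.normc z <= r ->
    Normc.normc (binomial_poly al N.+1 z - cpow_rhp (1 - z) (- al)) <= e N.
Proof.
move=> r01; have /andP[r0 r1] := r01.
have [K1 K10 HK1] := normc_cpow_rhp_le (al - 1) r1.
have [K2 K20 HK2] := normc_cpow_rhp_le (- al) r1.
(* [K1] bounds the power inside the derivative, 2 comes from [cmvt_le], and [K2] is the price of
   multiplying by (1 - z)^(-al) at the end. *)
exists (fun N => (K2 * (2 * K1)) * err al r N.+1).
  rewrite -[X in _ --> X](mulr0 (K2 * (2 * K1))).
  apply: cvgMr.
  by move: (binomial_err_cvg0 al r01); rewrite -(cvg_shiftS (err al r)).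
move=> N' z zr; set N := N'.+1.
have zu u : 0 <= u <= 1 -> Normc.normc (u%:C * z) <= r.
  move=> /andP[u0 u1]; rewrite Normc.normcM normc_real ger0_norm//.
  by rewrite (le_trans _ zr)// ler_piMl// normc_ge0.
pose g u := cpow_rhp (1 - u%:C * z) al * binomial_poly al N (u%:C * z).
pose dg u := - (z * cpow_rhp (1 - u%:C * z) (al - 1) *
  (N%:R * binomial_coef al N * (u%:C * z) ^+ N.-1)).
have dgg u : 0 <= u <= 1 -> is_cderive g u (dg u).
  move=> u01.
  have w0 := Re_onem_gt0 (le_lt_trans (zu u u01) r1).
  have d1 : is_cderive (fun u => u%:C * z) u z.
    apply: is_cderive_eq; first exact: (is_cderiveM (is_cderive_real u) (is_cderive_cst z u)).
    by rewrite mul1r mulr0 addr0.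
  have d2 : is_cderive (fun u => 1 - u%:C * z) u (- z).
    apply: is_cderive_eq.
      apply: (is_cderiveD (is_cderive_cst 1 u)).
      under eq_fun do rewrite -mulN1r.
      exact: (is_cderiveM (is_cderive_cst (-1) u) d1).
    by rewrite mul0r !add0r mulN1r.
  have d3 := is_cderive_cpow_rhp al w0 d2.
  have d4 : is_cderive (fun u => binomial_poly al N (u%:C * z)) u
      (\sum_(n < N) binomial_coef al n * (n%:R * (u%:C * z) ^+ n.-1 * z)).
    apply: (@is_cderive_sum _ (fun n u => binomial_coef al n * (u%:C * z) ^+ n)
      (fun n => binomial_coef al n * (n%:R * (u%:C * z) ^+ n.-1 * z))) => n.
    apply: is_cderive_eq.
      exact: (is_cderiveM (is_cderive_cst _ u) (is_cderiveX n d1)).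
    by rewrite mul0r add0r.
  apply: is_cderive_eq; first exact: (is_cderiveM d3 d4).
  rewrite (eq_bigr (fun n : 'I_N => (binomial_coef al n * (n%:R * (u%:C * z) ^+ n.-1)) * z)); last first.
    by move=> n _; rewrite !mulrA.
  (* Splitting al as (al - 1) + 1 frees a factor 1 - u z, so that the differential equation applies.
     The two terms al p_N then cancel and only the remainder is left. *)
  rewrite -mulr_suml -[X in cpow_rhp _ X * (_ * z)](subrK 1) (cpow_rhpD _ _ 1) cpow_rhp1//.
  rewrite mulrA -(mulrA (cpow_rhp _ _)) binomial_poly_deriv /dg; ring.
have g0 : g 0 = binomial_poly al N 0 by rewrite /g rmorph0 !mul0r subr0 cpow_rhp_1 mul1r.
have g1 : g 1 = cpow_rhp (1 - z) al * binomial_poly al N z by rewrite /g rmorph1 !mul1r.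
have dgK u : 0 < u < 1 -> Normc.normc (dg u) <= K1 * err al r N.
  move=> /andP[u0 u1]; have u01 : 0 <= u <= 1 by rewrite !ltW.
  have h1 := HK1 _ (zu u u01).
  have h2 : Normc.normc (u%:C * z) ^+ N' <= r ^+ N'.
    by rewrite lerXn2r ?nnegrE ?normc_ge0// zu.
  rewrite /dg normcN /err; move: (u%:C * z) h1 h2 => W.
  move: (cpow_rhp _ _) (binomial_coef _ _) => X c h1 h2.
  rewrite !Normc.normcM normc_nat normcX exprS /=.
  have -> : Normc.normc z * Normc.normc X *
      (N%:R * Normc.normc c * Normc.normc W ^+ N') =
    Normc.normc X * (N%:R * Normc.normc c * (Normc.normc z * Normc.normc W ^+ N')).
    by ring.
  apply: ler_pM => //; rewrite ?normc_ge0//.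
    by rewrite !mulr_ge0 ?normc_ge0// exprn_ge0 ?normc_ge0.
  apply: ler_wpM2l; first by rewrite mulr_ge0// normc_ge0.
  by apply: ler_pM => //; rewrite ?normc_ge0// exprn_ge0 ?normc_ge0.
have := cmvt_le ltr01 dgg dgK.
have P0 : binomial_poly al N 0 = 1.
  rewrite /binomial_poly big_ord_recl big1 ?addr0 /=.
    by rewrite expr0 mulr1 /binomial_coef /pochhammer big_ord0 fact0 divr1.
  by move=> i _; rewrite /bump /= exprS mul0r mulr0.
rewrite g0 g1 P0 subr0 mulr1 => h.
have z1 := le_lt_trans zr r1.
have -> : binomial_poly al N z - cpow_rhp (1 - z) (- al) =
  cpow_rhp (1 - z) (- al) * (cpow_rhp (1 - z) al * binomial_poly al N z - 1).
  by rewrite mulrBr mulr1 mulrA -cpow_rhpD addNr cpow_rhp0 mul1r.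
rewrite Normc.normcM -[leRHS]mulrA; apply: ler_pM; rewrite ?normc_ge0 ?HK2//.
by rewrite -mulrA.
Qed.

(** A bounded limit plus a bounded uniform error. The empty sum is treated apart because
    [binomial_series] starts with one term. *)
Lemma binomial_poly_bounded al r : 0 <= r < 1 ->
  exists2 M, 0 <= M & forall N z, Normc.normc z <= r ->
    Normc.normc (binomial_poly al N z) <= M.
Proof.
move=> r01; have /andP[r0 r1] := r01.
have [K K0 HK] := normc_cpow_rhp_le (- al) r1.
have [e e0 He] := binomial_series al r01.
have /cvg_seq_bounded[B0 [_ HB0]] : cvgn e by apply/cvg_ex; exists 0.
pose B := B0 + 1; have HB n : `|e n| <= B by apply: HB0 => //; rewrite ltrDl.
exists (B + K) => [|N z zr].
  rewrite addr_ge0 ?(ltW K0)//; apply: (le_trans (normr_ge0 (e 0%N))); exact: HB.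
case: N => [|N].
  rewrite /binomial_poly big_ord0 Normc.normc0 addr_ge0 ?(ltW K0)//.
  by apply: (le_trans (normr_ge0 (e 0%N))); exact: HB.
rewrite -[binomial_poly _ _ _](subrK (cpow_rhp (1 - z) (- al))).
rewrite (le_trans (le_normcD _ _))// lerD ?HK//.
by rewrite (le_trans (He _ _ zr))// (le_trans (ler_norm _))// HB.
Qed.

End binomial_series.

(** * Componentwise convergence of complex sequences *)

Section complex_sequences.
Context {R : realType}.
Implicit Types (u v : nat -> R[i]) (l : R[i]).

(** The componentwise form fits the real limit theorems for integrals; [ccvg_cvg] returns to the
    norm topology, in which [pFq] takes its limit. *)
Definition ccvg u l :=
  (complex.Re (u n) @[n --> \oo] --> complex.Re l) /\
  (complex.Im (u n) @[n --> \oo] --> complex.Im l).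

Lemma ccvg_cst l : ccvg (fun=> l) l.
Proof. by split; exact: cvg_cst. Qed.

Lemma ccvgM u v l l' : ccvg u l -> ccvg v l' ->
  ccvg (fun n => u n * v n) (l * l').
Proof.
move=> [u1 u2] [v1 v2]; split.
- rewrite ReM; under eq_fun do rewrite ReM.
  by apply: cvgB; apply: cvgM.
- rewrite ImM; under eq_fun do rewrite ImM.
  by apply: cvgD; apply: cvgM.
Qed.

Lemma ccvg_prod m (u : 'I_m -> nat -> R[i]) (l : 'I_m -> R[i]) :
  (forall j, ccvg (u j) (l j)) ->
  ccvg (fun n => \prod_(j < m) u j n) (\prod_(j < m) l j).
Proof.
elim: m u l => [|m IH] u l h.
  by rewrite big_ord0; under eq_fun do rewrite big_ord0; exact: ccvg_cst.
rewrite big_ord_recl; under eq_fun do rewrite big_ord_recl.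
by apply: ccvgM => //; exact: IH.
Qed.

Lemma ccvg_normc u l (e : nat -> R) : e @ \oo --> (0 : R) ->
  (forall n, Normc.normc (u n - l) <= e n) -> ccvg u l.
Proof.
move=> e0 h; split.
- apply/cvgrPdist_le => eps eps0; have := e0 => /cvgrPdist_le /(_ _ eps0).
  apply: filterS => n; rewrite sub0r normrN => en.
  have := normc_Re (u n - l); case: (u n) (l) (h n) => a b [c d] /= h1 h2.
  by rewrite distrC (le_trans h2)// (le_trans h1)// (le_trans _ en)// ler_norm.
- apply/cvgrPdist_le => eps eps0; have := e0 => /cvgrPdist_le /(_ _ eps0).
  apply: filterS => n; rewrite sub0r normrN => en.
  have := normc_Im (u n - l); case: (u n) (l) (h n) => a b [c d] /= h1 h2.
  by rewrite distrC (le_trans h2)// (le_trans h1)// (le_trans _ en)// ler_norm.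
Qed.

Lemma ccvg_unique u l l' : ccvg u l -> ccvg u l' -> l = l'.
Proof.
move=> [h1 h2] [h1' h2']; apply/eqP; rewrite eq_complex.
by rewrite (cvg_unique _ h1 h1')// (cvg_unique _ h2 h2')// !eqxx.
Qed.

Lemma ccvg_shiftS u l : ccvg (fun n => u n.+1) l -> ccvg u l.
Proof.
move=> [h1 h2]; split.
- by rewrite -(cvg_shiftS (fun n => complex.Re (u n))).
- by rewrite -(cvg_shiftS (fun n => complex.Im (u n))).
Qed.

Lemma ccvg_cvg (u : nat -> (R[i] : numFieldType)) l :
  ccvg u l -> u @ \oo --> (l : (R[i] : numFieldType)).
Proof.
move=> [h1 h2]; apply/cvgrPdist_le => eps eps0.
(* The order on [R[i]] only compares numbers with equal imaginary parts, so a positive [eps] is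
   real. *)
have epsE : eps = (complex.Re eps)%:C.
  by apply/esym; rewrite RRe_real// gtr0_real.
have e0 : 0 < complex.Re eps / 2 by rewrite divr_gt0// -ltcR -epsE.
move/cvgrPdist_le : h1 => /(_ _ e0) h1; move/cvgrPdist_le : h2 => /(_ _ e0) h2.
near=> n.
rewrite epsE -[X in X <= _]/((Normc.normc (l - u n))%:C) lecR.
rewrite (le_trans (normc_le_ReIm _))// (splitr (complex.Re eps)) lerD//.
- rewrite (_ : complex.Re _ = complex.Re l - complex.Re (u n)).
    by near: n.
  by case: (l) (u n) => a b [].
- rewrite (_ : complex.Im _ = complex.Im l - complex.Im (u n)).
    by near: n.
  by case: (l) (u n) => a b [].
Unshelve. all: by end_near. Qed.

End complex_sequences.

(** * Linearity and dominated convergence for complex integrals *)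

Section complex_integral.
Context {d : measure_display} {T : measurableType d} {R : realType}.
Variables (mu : {measure set T -> \bar R}) (D : set T).
Hypothesis mD : measurable D.
Implicit Types f g : T -> R[i].

Lemma eq_cintegrable f g : (forall x, D x -> f x = g x) ->
  cintegrable mu D f -> cintegrable mu D g.
Proof.
move=> fg [f1 f2]; split.
- by apply: eq_integrable f1 => // x /set_mem /fg ->.
- by apply: eq_integrable f2 => // x /set_mem /fg ->.
Qed.

Lemma eq_cintegral f g : (forall x, D x -> f x = g x) ->
  cintegral mu D f = cintegral mu D g.
Proof.
move=> fg; rewrite /cintegral; congr (_ +i* _); apply: eq_Rintegral => x /set_mem Dx;
  by rewrite fg.
Qed.

Lemma cintegrable0 : cintegrable mu D (fun=> 0).
Proof. by split; exact: integrable0. Qed.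

Lemma cintegrableD f g : cintegrable mu D f -> cintegrable mu D g ->
  cintegrable mu D (fun x => f x + g x).
Proof.
move=> [f1 f2] [g1 g2]; split.
- under eq_fun do rewrite ReD EFinD; exact: integrableD.
- under eq_fun do rewrite ImD EFinD; exact: integrableD.
Qed.

Lemma cintegralD f g : cintegrable mu D f -> cintegrable mu D g ->
  cintegral mu D (fun x => f x + g x) = cintegral mu D f + cintegral mu D g.
Proof.
move=> [f1 f2] [g1 g2]; rewrite /cintegral.
under eq_Rintegral do rewrite ReD.
under [X in _ +i* X]eq_Rintegral do rewrite ImD.
by rewrite !RintegralD.
Qed.

Lemma cintegrableZl z f : cintegrable mu D f -> cintegrable mu D (fun x => z * f x).
Proof.
move=> [f1 f2]; split.
- under eq_fun do rewrite ReM EFinB !EFinM.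
  by apply: integrableB => //; exact: integrableZl.
- under eq_fun do rewrite ImM EFinD !EFinM.
  by apply: integrableD => //; exact: integrableZl.
Qed.

Lemma cintegralZl z f : cintegrable mu D f ->
  cintegral mu D (fun x => z * f x) = z * cintegral mu D f.
Proof.
move=> [f1 f2]; rewrite /cintegral.
under eq_Rintegral do rewrite ReM.
under [X in _ +i* X]eq_Rintegral do rewrite ImM.
have h r (h : T -> R) : mu.-integrable D (fun x => (h x)%:E) ->
  mu.-integrable D (EFin \o (fun x => r * h x)).
  move=> ih; rewrite (_ : _ \o _ = (fun x => r%:E * (h x)%:E)%E)//.
  exact: integrableZl.
rewrite RintegralB ?RintegralD ?RintegralZl//; do ?exact: h.
by case: z => a b.
Qed.

Lemma cintegrable_sum I (s : seq I) (F : I -> T -> R[i]) :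
  (forall i, cintegrable mu D (F i)) ->
  cintegrable mu D (fun x => \sum_(i <- s) F i x).
Proof.
move=> h; elim: s => [|i s IH].
  by under eq_fun do rewrite big_nil; exact: cintegrable0.
by under eq_fun do rewrite big_cons; exact: cintegrableD.
Qed.

Lemma cintegral_sum I (s : seq I) (F : I -> T -> R[i]) :
  (forall i, cintegrable mu D (F i)) ->
  cintegral mu D (fun x => \sum_(i <- s) F i x) =
  \sum_(i <- s) cintegral mu D (F i).
Proof.
move=> h; elim: s => [|i s IH].
  rewrite big_nil /cintegral; under eq_Rintegral do rewrite big_nil.
  under [X in _ +i* X]eq_Rintegral do rewrite big_nil.
  by rewrite !Rintegral_cst// !mul0r.
rewrite big_cons -IH -cintegralD//; last exact: cintegrable_sum.
by apply: eq_cintegral => x _; rewrite big_cons.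
Qed.

(** The integrability of the limit is part of the conclusion: the existence of the residues and of
    the integral over the hypercube is obtained from it. *)
Lemma cdominated_convergence (f_ : nat -> T -> R[i]) f (g : T -> R) :
  (forall n, cintegrable mu D (f_ n)) ->
  (forall x, D x -> ccvg (f_ ^~ x) (f x)) ->
  mu.-integrable D (EFin \o g) ->
  (forall n x, D x -> Normc.normc (f_ n x) <= g x) ->
  cintegrable mu D f /\ ccvg (fun n => cintegral mu D (f_ n)) (cintegral mu D f).
Proof.
move=> if_ f_f ig f_g.
(* [p] stands for the real or the imaginary part. Both are bounded by the modulus, so a single [g]
   dominates both sequences. *)
have H (p : R[i] -> R) : (forall z, `|p z| <= Normc.normc z) ->
    (forall n, mu.-integrable D (fun x => (p (f_ n x))%:E)) ->
    (forall x, D x -> p (f_ n x) @[n --> \oo] --> p (f x)) ->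
    mu.-integrable D (fun x => (p (f x))%:E) /\
    (\int[mu]_(x in D) p (f_ n x))@[n --> \oo] --> \int[mu]_(x in D) p (f x).
  move=> pz ip cp.
  have c1 : forall x, D x -> (fun n => (p (f_ n x))%:E) @ \oo --> (p (f x))%:E.
    by move=> x Dx; apply: cvg_EFin; [exact: nearW|exact: cp].
  have m1 n := measurable_int _ (ip n).
  have m2 := @emeasurable_fun_cvg _ T R D (fun n x => (p (f_ n x))%:E)
    (fun x => (p (f x))%:E) m1 c1.
  have [||h1 _ h2] := @dominated_convergence _ _ _ mu D mD
    (fun n x => (p (f_ n x))%:E) (fun x => (p (f x))%:E) (EFin \o g) m1 m2 _ ig.
  - exact: aeW.
  - apply: aeW => x n Dx /=; rewrite lee_fin (le_trans (pz _))//; exact: f_g.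
  split => //.
  apply: (fine_cvg (f := fun n => (\int[mu]_(x in D) (p (f_ n x))%:E)%E)).
  by rewrite fineK//; exact: (integrable_fin_num mD h1).
have [r1 r2] := H _ (@normc_Re R) (fun n => (if_ n).1) (fun x Dx => (f_f x Dx).1).
have [i1 i2] := H _ (@normc_Im R) (fun n => (if_ n).2) (fun x Dx => (f_f x Dx).2).
by [].
Qed.

Lemma cintegral_mkcond f :
  cintegral mu D f = cintegral mu setT (fun x => if x \in D then f x else 0).
Proof.
rewrite /cintegral Rintegral_mkcond [X in _ +i* X]Rintegral_mkcond.
by congr (_ +i* _); apply: eq_Rintegral => x _; rewrite patchE; case: ifP.
Qed.

Lemma cintegrable_mkcond f :
  cintegrable mu D f <-> cintegrable mu setT (fun x => if x \in D then f x else 0).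
Proof.
rewrite /cintegrable (integrable_mkcond (fun x => (complex.Re (f x))%:E) mD).
rewrite (integrable_mkcond (fun x => (complex.Im (f x))%:E) mD).
have -> : (fun x => (complex.Re (f x))%:E) \_ D =
    (fun x => (complex.Re (if x \in D then f x else 0))%:E).
  by apply/funext => x; rewrite patchE; case: ifP.
have -> // : (fun x => (complex.Im (f x))%:E) \_ D =
    (fun x => (complex.Im (if x \in D then f x else 0))%:E).
by apply/funext => x; rewrite patchE; case: ifP.
Qed.

(** By [normc_le_ReIm] this sum dominates the modulus, and its integrability follows at once from
    that of the components. *)
Lemma cintegrable_normReIm f : cintegrable mu D f ->
  mu.-integrable D (EFin \o (fun x => `|complex.Re (f x)| + `|complex.Im (f x)|)).
Proof.
move=> [f1 f2]; have := integrableD mD (integrable_abse f1) (integrable_abse f2).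
by apply: eq_integrable.
Qed.

End complex_integral.

(** * Fubini's theorem for products of functions of separate variables *)

Section product_integral.
Local Open Scope ereal_scope.
Context {d1 d2 : measure_display} {T1 : measurableType d1} {T2 : measurableType d2}
  {R : realType}.
Variables (m1 : {sigma_finite_measure set T1 -> \bar R}).
Variables (m2 : {sigma_finite_measure set T2 -> \bar R}).

Lemma integrable_prodM (f : T1 -> R) (g : T2 -> R) :
  m1.-integrable setT (EFin \o f) -> m2.-integrable setT (EFin \o g) ->
  (m1 \x m2).-integrable setT (EFin \o (fun p => f p.1 * g p.2)%R).
Proof.
move=> fi gi.
have mf : measurable_fun setT f by apply/measurable_EFinP; exact: measurable_int fi.
have mg : measurable_fun setT g by apply/measurable_EFinP; exact: measurable_int gi.
have mfg : measurable_fun setT (EFin \o (fun p : T1 * T2 => f p.1 * g p.2)%R).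
  apply/measurable_EFinP; apply: measurable_funM.
    exact: measurableT_comp mf measurable_fst.
  exact: measurableT_comp mg measurable_snd.
apply/(integrable12ltyP m1 m2 mfg).
have /integrableP[_ fy] := fi; have /integrableP[_ gy] := gi.
rewrite (_ : \int[m1]_x _ = (\int[m1]_x `|(f x)%:E|) * \int[m2]_y `|(g y)%:E|).
  by rewrite lte_mul_pinfty//; [exact: integral_ge0|rewrite ge0_fin_numE//; exact: integral_ge0].
rewrite -ge0_integralZr//; last 2 first.
- by apply: measurableT_comp => //; exact/measurable_EFinP.
- exact: integral_ge0.
apply: eq_integral => x _.
rewrite -ge0_integralZl//; last first.
  by apply: measurableT_comp => //; exact/measurable_EFinP.
by apply: eq_integral => y _; rewrite /= normrM EFinM.
Qed.

Lemma Rintegral_prodM (f : T1 -> R) (g : T2 -> R) :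
  m1.-integrable setT (EFin \o f) -> m2.-integrable setT (EFin \o g) ->
  (\int[(m1 \x m2)%E]_p (f p.1 * g p.2) = (\int[m1]_x f x) * (\int[m2]_y g y))%R.
Proof.
move=> fi gi; have fgi := integrable_prodM fi gi.
rewrite {1}/Rintegral -integral12_prod_meas1//=.
rewrite -RintegralZr// /Rintegral; congr fine; apply: eq_integral => x _.
rewrite /fubini_F /=; under eq_integral do rewrite EFinM.
by rewrite integralZl// EFinM fineK//; exact: integrable_fin_num.
Qed.

End product_integral.

Section complex_product_integral.
Context {d1 d2 : measure_display} {T1 : measurableType d1} {T2 : measurableType d2}
  {R : realType}.
Variables (m1 : {sigma_finite_measure set T1 -> \bar R}).
Variables (m2 : {sigma_finite_measure set T2 -> \bar R}).
Variables (f : T1 -> R[i]) (g : T2 -> R[i]).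
Hypotheses (fi : cintegrable m1 setT f) (gi : cintegrable m2 setT g).

Lemma cintegrable_prodM :
  cintegrable (m1 \x m2)%E setT (fun p => f p.1 * g p.2).
Proof.
have [f1 f2] := fi; have [g1 g2] := gi; split.
- under eq_fun do rewrite ReM EFinB.
  apply: integrableB => //.
    exact: (integrable_prodM f1 g1).
  exact: (integrable_prodM f2 g2).
- under eq_fun do rewrite ImM EFinD.
  apply: integrableD => //.
    exact: (integrable_prodM f1 g2).
  exact: (integrable_prodM f2 g1).
Qed.

Lemma cintegral_prodM :
  cintegral (m1 \x m2)%E setT (fun p => f p.1 * g p.2) =
  cintegral m1 setT f * cintegral m2 setT g.
Proof.
have [f1 f2] := fi; have [g1 g2] := gi; rewrite /cintegral.
under eq_Rintegral do rewrite ReM.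
under [X in _ +i* X]eq_Rintegral do rewrite ImM.
have i11 := integrable_prodM f1 g1; have i22 := integrable_prodM f2 g2.
have i12 := integrable_prodM f1 g2; have i21 := integrable_prodM f2 g1.
rewrite RintegralB// RintegralD//.
by rewrite (Rintegral_prodM f1 g1) (Rintegral_prodM f2 g2) (Rintegral_prodM f1 g2) (Rintegral_prodM f2 g1).
Qed.

End complex_product_integral.

(** * Product integrands on n-dimensional boxes *)

Section tuple_integral.
Context {R : realType}.
Local Notation mu := (@lebesgue_measure R).

Lemma measurable_cprod n (f : 'I_n -> measurableTypeR R -> R[i]) :
  (forall i, cintegrable mu setT (f i)) ->
  measurable_fun setT (fun x : n.-tuple (measurableTypeR R) =>
    complex.Re (\prod_(i < n) f i (tnth x i))) /\
  measurable_fun setT (fun x : n.-tuple (measurableTypeR R) =>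
    complex.Im (\prod_(i < n) f i (tnth x i))).
Proof.
move=> fi.
have m1 i : measurable_fun setT (fun x : n.-tuple (measurableTypeR R) =>
    complex.Re (f i (tnth x i))).
  apply: (measurableT_comp (f := fun u => complex.Re (f i u))) (measurable_tnth i).
  by apply/measurable_EFinP; exact: measurable_int (fi i).1.
have m2 i : measurable_fun setT (fun x : n.-tuple (measurableTypeR R) =>
    complex.Im (f i (tnth x i))).
  apply: (measurableT_comp (f := fun u => complex.Im (f i u))) (measurable_tnth i).
  by apply/measurable_EFinP; exact: measurable_int (fi i).2.
(* The induction runs over the list of factors and leaves the dimension fixed, so the type of the
   tuple [x] does not change. *)
elim: (index_enum _) => [|i s [IH1 IH2]].
  split; under eq_fun do rewrite big_nil; exact: measurable_cst.
split; under eq_fun do rewrite big_cons.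
- under eq_fun do rewrite ReM.
  by apply: measurable_funB; apply: measurable_funM.
- under eq_fun do rewrite ImM.
  by apply: measurable_funD; apply: measurable_funM.
Qed.

(** [lebesgue_tuple n.+1] is the image under [tcons] of a product measure. Pulling back along
    [tcons] splits off the first factor, and Fubini separates it. In dimension 0 the measure is a
    Dirac mass, whose total mass 1 is the empty product. *)
Lemma cintegral_tuple_prod n (f : 'I_n -> measurableTypeR R -> R[i]) :
  (forall i, cintegrable mu setT (f i)) ->
  cintegrable (lebesgue_tuple n) setT (fun x => \prod_(i < n) f i (tnth x i)) /\
  cintegral (lebesgue_tuple n) setT (fun x => \prod_(i < n) f i (tnth x i)) =
  \prod_(i < n) cintegral mu setT (f i).
Proof.
elim: n f => [|n IH] f fi.
  under eq_fun do rewrite big_ord0; rewrite big_ord0 /cintegrable /cintegral /=.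
  split; first by split; exact: finite_measure_integrable_cst.
  by rewrite !Rintegral_cst//= /dirac indicT /= mul1r mul0r.
have [m1 m2] := measurable_cprod fi.
have [IHi IHE] := IH (fun i => f (lift ord0 i)) (fun i => fi _).
have gi := cintegrable_prodM (fi ord0) IHi.
have gE := cintegral_prodM (fi ord0) IHi.
have E p : \prod_(i < n.+1) f i (tnth (tcons p) i) =
  f ord0 p.1 * \prod_(i < n) f (lift ord0 i) (tnth p.2 i).
  rewrite big_ord_recl; congr (_ * _).
  by apply: eq_bigr => i _; rewrite tnthS.
have [g1 g2] := gi.
have mt := @measurable_tcons R n.
have i1 : ((lebesgue_measure \x lebesgue_tuple n)%E).-integrable setT
   ((fun x => (complex.Re (\prod_(i < n.+1) f i (tnth x i)))%:E) \o @tcons R n).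
  by apply: eq_integrable g1 => // p _; rewrite /= E.
have i2 : ((lebesgue_measure \x lebesgue_tuple n)%E).-integrable setT
   ((fun x => (complex.Im (\prod_(i < n.+1) f i (tnth x i)))%:E) \o @tcons R n).
  by apply: eq_integrable g2 => // p _; rewrite /= E.
split; first split.
- apply: (integrable_pushforward mt) => //; exact/measurable_EFinP.
- apply: (integrable_pushforward mt) => //; exact/measurable_EFinP.
rewrite big_ord_recl -IHE -gE /cintegral /Rintegral.
congr (fine _ +i* fine _).
- rewrite [LHS](integral_pushforward mt) => //; last exact/measurable_EFinP.
  by apply: eq_integral => p _; rewrite /= E.
- rewrite [LHS](integral_pushforward mt) => //; last exact/measurable_EFinP.
  by apply: eq_integral => p _; rewrite /= E.
Qed.

Lemma cintegral_box_prod n (A : 'I_n -> set (measurableTypeR R))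
    (f : 'I_n -> measurableTypeR R -> R[i]) :
  (forall i, measurable (A i)) -> (forall i, cintegrable mu (A i) (f i)) ->
  let B := [set x : n.-tuple (measurableTypeR R) | forall i, A i (tnth x i)] in
  cintegrable (lebesgue_tuple n) B (fun x => \prod_(i < n) f i (tnth x i)) /\
  cintegral (lebesgue_tuple n) B (fun x => \prod_(i < n) f i (tnth x i)) =
  \prod_(i < n) cintegral mu (A i) (f i).
Proof.
move=> mA fi B; have mB : measurable B := measurable_box mA.
(* The indicator of a box is the product of the indicators of its sides, so extending each factor by
   0 reduces the claim to the whole space. *)
pose g i u := if u \in A i then f i u else 0.
have gi i : cintegrable mu setT (g i) by apply/(cintegrable_mkcond mu (mA i) (f i)).
have [h1 h2] := cintegral_tuple_prod gi.
have E : (fun x : n.-tuple (measurableTypeR R) => \prod_(i < n) g i (tnth x i)) =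
    (fun x => if x \in B then \prod_(i < n) f i (tnth x i) else 0).
  apply/funext => x; case: ifPn => [/set_mem xB|/negP xB].
    by apply: eq_bigr => i _; rewrite /g mem_set//; exact: xB.
  have [i iA] : exists i, ~ A i (tnth x i).
    by apply/existsNP => h; apply: xB; rewrite mem_set.
  apply/eqP; rewrite prodf_seq_eq0; apply/hasP; exists i; first by rewrite mem_index_enum.
  by rewrite /= /g memNset.
rewrite E in h1 h2; split; first exact/(cintegrable_mkcond _ mB).
rewrite cintegral_mkcond// h2; apply: eq_bigr => i _.
by rewrite [RHS]cintegral_mkcond.
Qed.

End tuple_integral.

(** * The fundamental theorem of calculus and improper integrals over [0, 1[ *)

Section interval_integrals.
Context {R : realType}.
Local Notation mu := (@lebesgue_measure R).
Implicit Types (f F df : R -> R[i]) (a b : R).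

Lemma integrable_derivable (f df : R -> R) a b :
  (forall u, a <= u <= b -> is_derive u 1 f (df u)) ->
  mu.-integrable `[a, b] (EFin \o f).
Proof.
move=> ddf; apply: continuous_compact_integrable; first exact: segment_compact.
apply: derivable_within_continuous => u; rewrite in_itv /= => uab.
by have [] := ddf u uab.
Qed.

(** The derivative [df] of the integrand supplies the continuity that the fundamental theorem of
    calculus asks for. *)
Lemma Rintegral_derive (f F df : R -> R) a b : a < b ->
  (forall u, a <= u <= b -> is_derive u 1 F (f u)) ->
  (forall u, a <= u <= b -> is_derive u 1 f (df u)) ->
  \int[mu]_(u in `[a, b]) f u = F b - F a.
Proof.
move=> ab dF ddf.
have cf : {within `[a, b], continuous f}.
  apply: derivable_within_continuous => u; rewrite in_itv /= => uab.
  by have [] := ddf u uab.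
rewrite /Rintegral (continuous_FTC2 (F := F) ab cf)//.
- have cF u : a <= u <= b -> F x @[x --> u] --> F u.
    by move=> uab; exact: is_derive_continuous (dF u uab).
  split.
  + by move=> u /subset_itv_oo_cc; rewrite in_itv /= => /dF [].
  + by apply: cvg_at_right_filter; apply: cF; rewrite lexx ltW.
  + by apply: cvg_at_left_filter; apply: cF; rewrite lexx ltW.
- move=> u /subset_itv_oo_cc; rewrite in_itv /= => /dF d.
  by rewrite derive1E derive_val.
Qed.

Lemma cintegrable_cderivable f df a b :
  (forall u, a <= u <= b -> is_cderive f u (df u)) -> cintegrable mu `[a, b] f.
Proof.
move=> ddf; split.
- exact: (@integrable_derivable _ (fun u => complex.Re (df u)) _ _
    (fun u uab => (ddf u uab).1)).
- exact: (@integrable_derivable _ (fun u => complex.Im (df u)) _ _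
    (fun u uab => (ddf u uab).2)).
Qed.

Lemma cintegral_cderive f F df a b : a < b ->
  (forall u, a <= u <= b -> is_cderive F u (f u)) ->
  (forall u, a <= u <= b -> is_cderive f u (df u)) ->
  cintegral mu `[a, b] f = F b - F a.
Proof.
move=> ab dF ddf; rewrite /cintegral.
rewrite (@Rintegral_derive _ _ (fun u => complex.Re (df u)) _ _ ab
  (fun u uab => (dF u uab).1) (fun u uab => (ddf u uab).1)).
rewrite (@Rintegral_derive _ _ (fun u => complex.Im (df u)) _ _ ab
  (fun u uab => (dF u uab).2) (fun u uab => (ddf u uab).2)).
by case: (F b) (F a) => x y [].
Qed.

(** With [n.+2] the sequence starts at 1/2, so that every interval [0, b_n] is non-degenerate. *)
Let b_ (n : nat) : R := 1 - n.+2%:R^-1.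

Let b_gt0 n : 0 < b_ n.
Proof. by rewrite subr_gt0 invf_lt1// ltr1n. Qed.

Let b_lt1 n : b_ n < 1.
Proof. by rewrite gtrBl invr_gt0. Qed.

Let D : set (measurableTypeR R) := `[0%R, 1%R[%classic.
Let I_ n : set (measurableTypeR R) := `[0%R, b_ n]%classic.

Let I_D n : I_ n `<=` D.
Proof.
move=> x; rewrite /I_ /D /= !in_itv /= => /andP[-> xb] /=.
exact: le_lt_trans xb (b_lt1 n).
Qed.

Let mD : measurable D. Proof. exact: measurable_itv. Qed.
Let mI n : measurable (I_ n). Proof. exact: measurable_itv. Qed.

Let b_cvg : (1 - b_ n) @[n --> \oo] --> (0 : R).
Proof.
rewrite (_ : (fun n => _) = (fun n => n.+2%:R^-1)); last first.
  by apply/funext => n; rewrite /b_ opprB addrCA subrr addr0.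
by rewrite (cvg_shiftS (fun n => n.+1%:R^-1 : R)); exact: cvg_harmonic.
Qed.

Let nearI x : D x -> \forall n \near \oo, x \in I_ n.
Proof.
rewrite /D /= in_itv /= => /andP[x0 x1].
have /cvgrPdist_lt/(_ (1 - x)) := b_cvg.
rewrite subr_gt0 => /(_ x1); apply: filterS => n.
rewrite sub0r normrN ger0_norm ?subr_ge0 ?(ltW (b_lt1 n))// => h.
by rewrite inE /I_ /= in_itv /= x0 /=; lra.
Qed.

(** The truncations of [h] to [0, b_n] increase to [h], so by monotone convergence [B] also bounds
    the integral over [0, 1[. *)
Lemma integrable_right_open (h : R -> R) (B : R) :
  (forall u, 0 <= u < 1 -> 0 <= h u) ->
  (forall b, 0 < b < 1 -> mu.-integrable `[0, b] (EFin \o h) /\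
     \int[mu]_(u in `[0, b]) h u <= B) ->
  mu.-integrable `[0, 1[ (EFin \o h).
Proof.
move=> h0 hB.
pose g n : R -> \bar R := (EFin \o h) \_ (I_ n).
have gi n : mu.-integrable setT (g n).
  by apply/(integrable_mkcond _ (mI n)).1; apply: (hB _ _).1; rewrite b_gt0 b_lt1.
have mg n : measurable_fun D (g n).
  by apply: measurable_funTS; exact: measurable_int (gi n).
have gh x : D x -> g n x @[n --> \oo] --> (h x)%:E.
  move=> Dx; apply: cvg_near_cst; have := nearI Dx; apply: filterS => n xI.
  by rewrite /g patchE xI.
have mh : measurable_fun D (EFin \o h).
  exact: (emeasurable_fun_cvg g (EFin \o h) mg gh).
apply/integrableP; split => //.
have hD x : D x -> 0 <= h x by rewrite /D /= in_itv; exact: h0.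
have -> : (\int[mu]_(x in D) `|(EFin \o h) x| = \int[mu]_(x in D) (EFin \o h) x)%E.
  by apply: eq_integral => x /set_mem Dx; rewrite /= ger0_norm// hD.
have g0 n x : D x -> (0 <= g n x)%E.
  by move=> Dx; rewrite /g patchE; case: ifP => // _; rewrite lee_fin hD.
have nd x : D x -> {homo g^~ x : n m / (n <= m)%N >-> (n <= m)%E}.
  move=> Dx n m nm; rewrite /g !patchE.
  case: ifPn => [xn|_]; last by case: ifP => // _; rewrite lee_fin hD.
  rewrite ifT//; move: xn; rewrite !inE /I_ /= !in_itv /= => /andP[-> /le_trans]; apply.
  by rewrite lerD2l lerN2 lef_pV2 ?posrE// ler_nat ltnS ltnS.
have -> : (\int[mu]_(x in D) (EFin \o h) x = limn (fun n => \int[mu]_(x in D) g n x))%E.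
  rewrite -(monotone_convergence mu mD mg g0 nd).
  by apply: eq_integral => x /set_mem Dx; apply/esym/cvg_lim => //; exact: gh.
apply: (@le_lt_trans _ _ B%:E); last exact: ltry.
apply: lime_le.
  apply: ereal_nondecreasing_is_cvgn => n m nm.
  apply: ge0_le_integral => //; last by move=> x Dx; exact: nd.
  by move=> x Dx; exact: g0.
apply: nearW => n.
have /hB[i1 i2] : 0 < b_ n < 1 by rewrite b_gt0 b_lt1.
rewrite -[X in (X <= _)%E]/(\int[mu]_(x in D) ((EFin \o h) \_ (I_ n)) x)%E.
rewrite -integral_mkcondr (setIidr (I_D (n := n))).
rewrite -[X in (X <= _)%E]fineK; last exact: (integrable_fin_num (mI n) i1).
by rewrite lee_fin.
Qed.

Let f_cut f n x : R[i] := if x \in I_ n then f x else 0.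

Let cintegrable_cut f n : cintegrable mu (I_ n) f -> cintegrable mu D (f_cut f n).
Proof.
move=> /(cintegrable_mkcond _ (mI n))[h1 h2].
by split; apply: integrableS (@measurableT _ _) mD _ _.
Qed.

Let cintegral_cut f n : cintegral mu D (f_cut f n) = cintegral mu (I_ n) f.
Proof.
rewrite (cintegral_mkcond _ D) (cintegral_mkcond _ (I_ n)); congr cintegral.
apply/funext => x; rewrite /f_cut; case: ifP => // xD; case: ifP => // xI.
by move/set_mem/I_D/mem_set : xI; rewrite xD.
Qed.

(** Dominated convergence for the truncations of [f] to [0, b_n]: at each point of [0, 1[ they are
    eventually constant in n. *)
Lemma cdominated_right_open f (g : R -> R) :
  (forall b, 0 < b < 1 -> cintegrable mu `[0, b] f) ->
  (forall u, 0 <= u < 1 -> Normc.normc (f u) <= g u) ->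
  mu.-integrable `[0, 1[ (EFin \o g) ->
  cintegrable mu `[0, 1[ f /\
  ccvg (fun n => cintegral mu `[0, 1 - n.+2%:R^-1] f) (cintegral mu `[0, 1[ f).
Proof.
move=> fi fg ig.
have fin n : cintegrable mu D (f_cut f n).
  by apply: cintegrable_cut; apply: fi; rewrite b_gt0 b_lt1.
have fD x : D x -> Normc.normc (f x) <= g x by rewrite /D /= in_itv; exact: fg.
have [||h1 h2] := cdominated_convergence (f := f) mD fin _ ig.
- move=> x Dx; split; apply: cvg_near_cst; have := nearI Dx;
    by apply: filterS => n xI; rewrite /f_cut xI.
- move=> n x Dx; rewrite /f_cut; case: ifP => _; first exact: fD.
  by rewrite Normc.normc0 (le_trans _ (fD _ Dx))// normc_ge0.
by split => //; under eq_fun do rewrite -/(I_ _) -cintegral_cut.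
Qed.

End interval_integrals.

(** * Orthogonality of the characters of the circle *)

Section circle_integral.
Context {R : realType}.
Local Notation mu := (@lebesgue_measure R).

Lemma cis2pi : cis (2 * pi : R) = 1.
Proof. by rewrite mulrC mulr_natr /cis cos2pi sin2pi. Qed.

(** The integrand is exp(c u) with c = i(n - m). For c nonzero its primitive [c^-1 * f] is periodic.
    A quotient of natural powers is used because the last torus coordinate is the inverse of the
    product of the others. *)
Lemma circle_integral n m :
  let f u : R[i] := cis u ^+ n / cis u ^+ m in
  cintegrable mu `[0, 2 * pi] f /\
  cintegral mu `[0, 2 * pi] f = if n == m then (2 * pi)%:C else 0.
Proof.
move=> f; have pi0 : 0 < 2 * pi :> R by rewrite mulr_gt0 ?pi_gt0.
pose c : R[i] := 0 +i* (n%:R - m%:R).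
have fE : f = fun u => cexp (c * u%:C).
  apply/funext => u; rewrite /f -!cisMn -cisN -cisD /cexp ReM ImM /=.
  rewrite !mul0r mulr0 subrr expR0 mul1r add0r; congr cis.
  by rewrite mulrBl !mulr_natl.
have dc u : is_cderive (fun u => c * u%:C) u c.
  apply: is_cderive_eq; first exact: (is_cderiveM (is_cderive_cst c u) (is_cderive_real u)).
  by rewrite mul0r add0r mulr1.
have df u : is_cderive f u (c * f u) by rewrite fE; exact: is_cderive_cexp.
split; first exact: (cintegrable_cderivable (df := fun u => c * f u)).
case: eqVneq => [nm|nm].
  have f1 : f = fun=> 1.
    by rewrite fE; apply/funext => u; rewrite /c nm subrr mul0r cexp0.
  rewrite (@cintegral_cderive _ f (fun u => u%:C) (fun u => c * f u) _ _ pi0).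
  - by rewrite subr0.
  - by move=> u _; rewrite f1; exact: is_cderive_real.
  - by move=> u _; exact: df.
have c0 : c != 0.
  by apply: contra nm => /eqP[] /eqP; rewrite subr_eq0 eqr_nat.
rewrite (@cintegral_cderive _ f (fun u => c^-1 * f u) (fun u => c * f u) _ _ pi0).
- by rewrite /f cis2pi !expr1n cis0 !expr1n divr1 subrr.
- move=> u _; apply: is_cderive_eq.
    exact: (is_cderiveM (is_cderive_cst c^-1 u) (df u)).
  by rewrite mul0r add0r mulKf.
- by move=> u _; exact: df.
Qed.

End circle_integral.

(** * The Beta integral with complex exponent *)

Section beta_integral.
Context {R : realType}.
Local Notation mu := (@lebesgue_measure R).
Implicit Types (v w : R[i]).

(* At u = 1 the kernel takes the junk value given by the logarithm of 0, whence
   the intervals open on the right and the limit u --> 1. *)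
Let kernel v n (u : R) : R[i] := cpow_rhp (1 - u)%:C v * u%:C ^+ n.

(* Writing (1 - u)^v as (1 - u)^(v - 1) (1 - u) turns the derivative of the
   kernel into the recurrence n I_(n-1) = (n + v) I_n of the Beta integral. *)
Let dkernel v n u : R[i] :=
  n%:R * kernel (v - 1) n.-1 u - (n%:R + v) * kernel (v - 1) n u.

Let is_cderive_kernel v n u : u < 1 -> is_cderive (kernel v n) u (dkernel v n u).
Proof.
move=> u1; have u0 : 0 < complex.Re (1 - u)%:C by rewrite /= subr_gt0.
have d1 : is_cderive (fun u => (1 - u)%:C) u (-1).
  split => /=; first by apply: is_derive_eq; rewrite add0r mul1r.
  by apply: (is_derive_eq (is_derive_cst _ _ _)); rewrite oppr0.
have d2 := is_cderive_cpow_rhp (f := fun u => (1 - u)%:C) v u0 d1.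
apply: is_cderive_eq; first exact: (is_cderiveM d2 (is_cderiveX n (is_cderive_real u))).
rewrite /dkernel /kernel.
have -> : cpow_rhp (1 - u)%:C v = cpow_rhp (1 - u)%:C (v - 1) * (1 - u)%:C.
  by rewrite -{1}[v](subrK 1) (cpow_rhpD _ _ 1) cpow_rhp1.
rewrite rmorphB rmorph1; case: n => [|n]; first by rewrite !mul0r expr0; ring.
by rewrite exprS /=; ring.
Qed.

Let kernel_right_cderive v n u : 0 <= u < 1 -> is_cderive (kernel v n) u (dkernel v n u).
Proof. by move=> /andP[_]; exact: is_cderive_kernel. Qed.

Let normc_kernel v n u : 0 <= u < 1 ->
  Normc.normc (kernel v n u) <= (1 - u) `^ complex.Re v.
Proof.
move=> /andP[u0 u1]; rewrite Normc.normcM normc_cpow_rhp_real ?subr_gt0//.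
by rewrite normcX normc_real ger0_norm// ler_piMr ?powR_ge0// exprn_ile1// ltW.
Qed.

Let sub01 (b u : R) : 0 < b < 1 -> 0 <= u <= b -> 0 <= u < 1.
Proof. by move=> /andP[_ b1] /andP[-> ub] /=; exact: le_lt_trans b1. Qed.

(** Integrates the modulus of the Beta weight, with r = Re beta - 1. A primitive is -(1 - u)^r / r,
    so 1/r bounds the integrals over [0, b]. *)
Let integrable_powR (r : R) : 0 < r ->
  mu.-integrable `[0, 1[ (EFin \o (fun u => (1 - u) `^ (r - 1))).
Proof.
move=> r0.
have kE s u : u < 1 -> kernel s%:C 0 u = ((1 - u) `^ s)%:C.
  move=> u1; rewrite /kernel expr0 mulr1 /cpow_rhp clog_rhp_real ?subr_gt0//.
  rewrite /cexp ReM ImM /= !mul0r subr0 mulr0 addr0 cis0 mulr1.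
  by rewrite /powR gt_eqF// subr_gt0.
apply: (@integrable_right_open _ _ r^-1) => [u _|b b01]; first exact: powR_ge0.
have /andP[b0 b1] := b01.
have rC : r%:C != 0 :> R[i] by rewrite eq_complex /= eqxx andbT gt_eqF.
have [h1 _] : cintegrable mu `[0, b] (kernel (r%:C - 1) 0).
  apply: (cintegrable_cderivable (df := dkernel (r%:C - 1) 0)).
  by move=> u /(sub01 b01) u01; exact: kernel_right_cderive.
have h2 : cintegral mu `[0, b] (kernel (r%:C - 1) 0) =
    (r%:C)^-1 * (kernel r%:C 0 0 - kernel r%:C 0 b).
  rewrite (@cintegral_cderive _ _ (fun u => - (r%:C)^-1 * kernel r%:C 0 u)
    (dkernel (r%:C - 1) 0) _ _ b0); first by ring.
  - move=> u /(sub01 b01) u01; apply: is_cderive_eq.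
      exact: (is_cderiveM (is_cderive_cst _ u) (kernel_right_cderive _ _ u01)).
    by rewrite /dkernel; field.
  - by move=> u /(sub01 b01) u01; exact: kernel_right_cderive.
have rE : r%:C - 1 = (r - 1)%:C :> R[i] by rewrite rmorphB.
split.
  apply: eq_integrable h1 => // u /set_mem; rewrite [X in X -> _]/= in_itv.
  by move=> /(sub01 b01)/andP[_ u1]; rewrite rE kE.
have -> : \int[mu]_(u in `[0, b]) (1 - u) `^ (r - 1) =
    complex.Re (cintegral mu `[0, b] (kernel (r%:C - 1) 0)).
  apply: eq_Rintegral => u /set_mem; rewrite [X in X -> _]/= in_itv.
  by move=> /(sub01 b01)/andP[_ u1]; rewrite rE kE.
rewrite h2 !kE// subr0 powR1 -fmorphV -rmorphB -rmorphM [leLHS]/=.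
by rewrite ler_piMr ?invr_ge0 ?(ltW r0)// gerBl powR_ge0.
Qed.

Let cintegrable_kernel v n : 0 < complex.Re v ->
  cintegrable mu `[0, 1[ (kernel (v - 1) n).
Proof.
move=> v0.
have [||//] := @cdominated_right_open _ (kernel (v - 1) n)
  (fun u => (1 - u) `^ (complex.Re v - 1)) _ _ (integrable_powR v0).
- move=> b b01; have /andP[b0 b1] := b01.
  apply: (cintegrable_cderivable (df := dkernel (v - 1) n)).
  by move=> u /(sub01 b01) u01; exact: kernel_right_cderive.
- move=> u u01; apply: (le_trans (normc_kernel _ _ u01)).
  by case: (v).
Qed.

Let dkernelE v n : dkernel v n =
  fun u => n%:R * kernel (v - 1) n.-1 u + - (n%:R + v) * kernel (v - 1) n u.
Proof. by apply/funext => u; rewrite /dkernel mulNr. Qed.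

Let is_cderive_dkernel v n u : 0 <= u < 1 -> is_cderive (dkernel v n) u
  (n%:R * dkernel (v - 1) n.-1 u + - (n%:R + v) * dkernel (v - 1) n u).
Proof.
move=> u01; rewrite dkernelE; apply: is_cderive_eq.
  apply: is_cderiveD.
    exact: (is_cderiveM (is_cderive_cst _ u) (kernel_right_cderive _ _ u01)).
  exact: (is_cderiveM (is_cderive_cst _ u) (kernel_right_cderive _ _ u01)).
by rewrite !mul0r !add0r.
Qed.

(** The boundary term at 1 vanishes because |kernel| <= (1 - u)^(Re v) with Re v > 0; at 0 the
    kernel is 1 for n = 0 and 0 otherwise. *)
Let cintegral_dkernel v n : 0 < complex.Re v ->
  cintegral mu `[0, 1[ (dkernel v n) = - (n == 0%N)%:R.
Proof.
move=> v0.
have k1 := cintegrable_kernel n.-1 v0; have k2 := cintegrable_kernel n v0.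
have ik : cintegrable mu `[0, 1[ (dkernel v n).
  rewrite dkernelE.
  by apply: cintegrableD; rewrite ?measurable_itv//; apply: cintegrableZl.
have ig : mu.-integrable `[0, 1[ (EFin \o
    (fun u => `|complex.Re (dkernel v n u)| + `|complex.Im (dkernel v n u)|)).
  by apply: cintegrable_normReIm.
have [||_] := @cdominated_right_open _ (dkernel v n) _ _ _ ig.
- move=> b b01; apply: cintegrable_cderivable => u /(sub01 b01).
  exact: is_cderive_dkernel.
- by move=> u _; exact: normc_le_ReIm.
pose b_ k : R := 1 - k.+2%:R^-1.
have b01 k : 0 < b_ k < 1.
  by apply/andP; rewrite subr_gt0 invf_lt1// ltr1n gtrBl invr_gt0.
have -> : (fun k => cintegral mu `[0, 1 - k.+2%:R^-1] (dkernel v n)) =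
    (fun k => kernel v n (b_ k) - (n == 0%N)%:R).
  apply/funext => k; have /andP[b0 b1] := b01 k.
  rewrite (cintegral_cderive (F := kernel v n) b0
    (fun u ub => kernel_right_cderive v n (sub01 (b01 k) ub))
    (fun u ub => is_cderive_dkernel v n (sub01 (b01 k) ub))).
  by rewrite /kernel subr0 cpow_rhp_1 mul1r expr0n.
move=> h.
have h' : ccvg (fun k => kernel v n (b_ k) - (n == 0%N)%:R) (- (n == 0%N)%:R).
  apply: (@ccvg_normc _ _ _ (fun k => k.+2%:R^-1 `^ complex.Re v)); last first.
    move=> k; rewrite opprK subrK; have /andP[b0 b1] := b01 k.
    apply: (le_trans (normc_kernel _ _ _)); first by rewrite ltW.
    by rewrite /b_ opprB addrCA subrr addr0.
  (* [powR_cvg0] concerns the right limit at 0, so the sequence has to tend to 0 through positive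
     values. *)
  have hc : (fun k => k.+2%:R^-1 : R) @ \oo --> 0^'+.
    move=> A A0; have h0 : (fun k => k.+2%:R^-1 : R) @ \oo --> 0.
      by rewrite (cvg_shiftS (fun k => k.+1%:R^-1 : R)); exact: cvg_harmonic.
    have h1 : \forall k \near \oo, 0 < k.+2%:R^-1 -> A k.+2%:R^-1 := h0 _ A0.
    change (\forall k \near \oo, A k.+2%:R^-1); apply: filterS h1 => k; apply.
    by rewrite invr_gt0.
  exact: (cvg_comp _ _ hc (powR_cvg0 v0)).
exact: ccvg_unique h h'.
Qed.

Lemma beta_integral w n : 1 < complex.Re w ->
  let f (u : R) := cpow (1 - u)%:C (w - 2) * u%:C ^+ n in
  cintegrable mu `]0, 1[ f /\
  cintegral mu `]0, 1[ f = n`!%:R / ((w - 1) * pochhammer w n).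
Proof.
move=> w1 f; pose v := w - 1.
have v0 : 0 < complex.Re v by rewrite /v; case: (w) w1 => a b /= ; rewrite subr_gt0.
have fE u : u \in `]0, 1[ -> f u = kernel (v - 1) n u.
  rewrite in_itv /= => /andP[_ u1].
  rewrite /f /kernel cpow_rhpE /= ?subr_gt0//; congr (cpow_rhp _ _ * _).
  by rewrite /v; ring.
have ki : cintegrable mu `]0, 1[ (kernel (v - 1) n).
  have [h1 h2] := cintegrable_kernel n v0.
  by split; [apply: integrableS h1 => //|apply: integrableS h2 => //];
    apply: subset_itvr; rewrite bnd_simp.
have fi : cintegrable mu `]0, 1[ f.
  apply: (@eq_cintegrable _ _ _ mu `]0, 1[%classic _ (kernel (v - 1) n)) => //.
  by move=> u u01; rewrite fE.
split => //.
(* The point 0 is added at no cost, being a null set; the primitive [kernel v n] is then evaluated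
   there. *)
have -> : cintegral mu `]0, 1[ f = cintegral mu `[0, 1[ (kernel (v - 1) n).
  have [i1 i2] := ki.
  rewrite (@eq_cintegral _ _ _ mu _ f (kernel (v - 1) n)) => [|u u01]; last by rewrite fE.
  by rewrite /cintegral !Rintegral_itv_obnd_cbnd.
have rec m : (m%:R + v) * cintegral mu `[0, 1[ (kernel (v - 1) m) =
  m%:R * cintegral mu `[0, 1[ (kernel (v - 1) m.-1) + (m == 0%N)%:R.
  have := cintegral_dkernel m v0; rewrite dkernelE.
  have k1 := cintegrable_kernel m.-1 v0; have k2 := cintegrable_kernel m v0.
  rewrite cintegralD ?cintegralZl//; do ?exact: cintegrableZl.
  by move/eqP; rewrite mulNr => /eqP h; rewrite -[(m == _)%:R]opprK -h; ring.
have vn0 m : m%:R + v != 0.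
  apply/eqP => /(congr1 (@complex.Re R)); rewrite ReD -(rmorph_nat (real_complex R)) /=.
  by move/eqP; rewrite gt_eqF// ltr_wpDl.
have vE : v = 0%:R + v by rewrite add0r.
rewrite -/v; elim: {fi f fE ki} n => [|n IH].
  have := rec 0%N; rewrite mul0r !add0r /pochhammer big_ord0 mulr1 fact0 => h.
  by apply: (mulfI (vn0 0%N)); rewrite -vE h div1r divff// vE.
apply: (mulfI (vn0 n.+1)); rewrite rec /= addr0 IH.
(* The factor [n.+1 + v] of the recurrence is the new last factor of the Pochhammer symbol. *)
have wE : w + n%:R = n.+1%:R + v by rewrite /v -natr1; ring.
rewrite /pochhammer big_ord_recr /= -/(pochhammer w n) wE factS natrM.
rewrite (mulrA v) [in RHS]invfM [RHS]mulrC -!mulrA mulVf ?mulr1//.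
Qed.

End beta_integral.

(** * The residue as a diagonal series *)

Section torus_expansion.
Context {R : realType} {q : nat}.
Local Notation tup := (q.-tuple (measurableTypeR R)).
Local Notation mu := (lebesgue_tuple q).
Variable al : (q + 1).-tuple R[i].

Definition diag_coef n : R[i] := \prod_(j < q + 1) binomial_coef (tnth al j) n.

(** All factors are truncated at the same order, so the diagonal exponents that survive integration
    are exactly those with n < N. *)
Definition torus_poly eta N (x : q.-tuple R) : R[i] :=
  \prod_(j < q + 1) binomial_poly (tnth al j) N (torus x 0 j * eta).

Let I : set (measurableTypeR R) := `[0%R, 2 * pi]%classic.

Lemma anglesE : angles = [set x : tup | forall k, I (tnth x k)].
Proof. by apply/seteqP; split => x /= h k; move: (h k); rewrite /I /= in_itv. Qed.

Let mI : measurable I. Proof. exact: measurable_itv. Qed.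

(** Substituting the last coordinate, the inverse of the product of the others, separates the
    angles. *)
Lemma torus_monomial (x : q.-tuple R) (f : 'I_(q + 1) -> nat) :
  \prod_(j < q + 1) torus x 0 j ^+ f j =
  \prod_(k < q) (cis (tnth x k) ^+ f (lshift 1 k) / cis (tnth x k) ^+ f (rshift q ord0)).
Proof.
rewrite big_split_ord /= big_ord1 big_split /=; congr (_ * _).
  by apply: eq_bigr => k _; rewrite row_mxEl mxE.
by rewrite row_mxEr mxE exprVn prodfV prodrXl.
Qed.

Lemma torus_monomial_integral (f : 'I_(q + 1) -> nat) :
  cintegrable mu angles (fun x : tup => \prod_(j < q + 1) torus x 0 j ^+ f j) /\
  cintegral mu angles (fun x : tup => \prod_(j < q + 1) torus x 0 j ^+ f j) =
  \prod_(k < q) (if f (lshift 1 k) == f (rshift q ord0) then (2 * pi)%:C else 0).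
Proof.
have E : (fun x : tup => \prod_(j < q + 1) torus x 0 j ^+ f j) =
    (fun x => \prod_(k < q) (cis (tnth x k) ^+ f (lshift 1 k) /
      cis (tnth x k) ^+ f (rshift q ord0))).
  by apply/funext => x; exact: torus_monomial.
have ci (k : 'I_q) : cintegrable lebesgue_measure I (fun u =>
    cis u ^+ f (lshift 1 k) / cis u ^+ f (rshift q ord0)).
  by have [] := @circle_integral R (f (lshift 1 k)) (f (rshift q ord0)).
have [h1 h2] := cintegral_box_prod (fun=> mI) ci.
rewrite E anglesE; split => //; rewrite h2; apply: eq_bigr => k _.
by have [] := @circle_integral R (f (lshift 1 k)) (f (rshift q ord0)).
Qed.

Lemma torus_poly_expand eta N x : torus_poly eta N x =
  \sum_(f : {ffun 'I_(q + 1) -> 'I_N})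
    (\prod_(j < q + 1) (binomial_coef (tnth al j) (f j) * eta ^+ f j)) *
    \prod_(j < q + 1) torus x 0 j ^+ f j.
Proof.
rewrite /torus_poly /binomial_poly bigA_distr_bigA; apply: eq_bigr => f _.
rewrite -big_split; apply: eq_bigr => j _ /=.
by rewrite exprMn [torus x 0 j ^+ _ * _]mulrC mulrA.
Qed.

Lemma torus_poly_integral eta N :
  cintegrable mu angles (torus_poly eta N) /\
  cintegral mu angles (torus_poly eta N) =
  (2 * pi)%:C ^+ q * \sum_(n < N) diag_coef n * (eta ^+ (q + 1)) ^+ n.
Proof.
have mA := @measurable_angles R q.
have E : torus_poly eta N = (fun x : tup => \sum_(f : {ffun 'I_(q + 1) -> 'I_N})
    (\prod_(j < q + 1) (binomial_coef (tnth al j) (f j) * eta ^+ f j)) *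
    \prod_(j < q + 1) torus x 0 j ^+ f j).
  by apply/funext => x; exact: torus_poly_expand.
have i1 (f : {ffun 'I_(q + 1) -> 'I_N}) := (torus_monomial_integral (fun j => f j)).1.
rewrite E; split.
  by apply: cintegrable_sum => // f; apply: cintegrableZl.
rewrite cintegral_sum//; last by move=> f; apply: cintegrableZl.
(* Exponent vectors are grouped by their last entry [n]. Within a group only the constant vector
   contributes: any other has an entry different from [n], and the integral over that angle is 0. *)
rewrite (partition_big (fun f : {ffun 'I_(q + 1) -> 'I_N} => f (rshift q ord0)) xpredT)//=.
rewrite mulr_sumr; apply: eq_bigr => n _.
rewrite (bigD1 [ffun=> n]) ?ffunE//= [X in _ + X]big1 ?addr0; last first.
  move=> f /andP[/eqP fn fN]; rewrite cintegralZl// (torus_monomial_integral _).2.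
  have [k kn] : exists k, f (lshift 1 k) != n.
    apply/existsP; apply: contraNT fN => /existsPn h; apply/eqP/ffunP => j.
    rewrite ffunE; case: (split_ordP j) => k ->; first by apply/eqP; rewrite -[_ == _]negbK.
    by rewrite ord1 fn.
  rewrite (bigD1 k) //= fn ifN ?mul0r ?mulr0//.
rewrite cintegralZl// (torus_monomial_integral _).2 mulrC; congr (_ * _).
  under eq_bigr do rewrite !ffunE eqxx.
  by rewrite prodr_const card_ord.
under eq_bigr do rewrite ffunE.
by rewrite big_split /= prodr_const card_ord -!exprM mulnC.
Qed.

Let omega eta (a : 'rV[R[i]]_(q + 1)) (V : 'M[R[i]]_(q, q + 1)) : R[i] :=
  \prod_(j < q + 1) cpow (1 - a 0 j * eta) (- tnth al j) * gelfand_leray a V.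

Lemma normc_torus (x : q.-tuple R) j : Normc.normc (torus x 0 j) = 1.
Proof.
have [k ->|k ->] := split_ordP j; first by rewrite row_mxEl mxE normc_cis.
rewrite row_mxEr mxE Normc.normcV normc_prod big1 ?invr1// => i _.
exact: normc_cis.
Qed.

Lemma torus_poly_bounded r : 0 <= r < 1 ->
  exists2 M, 0 <= M & forall eta N x, Normc.normc eta <= r ->
    Normc.normc (torus_poly eta N x) <= M.
Proof.
move=> r01.
have /choice[M HM] : forall j : 'I_(q + 1), exists M, 0 <= M /\ forall N z,
    Normc.normc z <= r -> Normc.normc (binomial_poly (tnth al j) N z) <= M.
  by move=> j; have [M M0 h] := binomial_poly_bounded (tnth al j) r01; exists M.
exists (\prod_j M j); first by apply: prodr_ge0 => j _; exact: (HM j).1.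
move=> eta N x er; rewrite normc_prod; apply: ler_prod => j _.
rewrite normc_ge0 /=; apply: (HM j).2.
by rewrite Normc.normcM normc_torus mul1r.
Qed.

Lemma torus_poly_cvg eta x : Normc.normc eta < 1 ->
  ccvg (fun N => torus_poly eta N.+1 x)
    (\prod_(j < q + 1) cpow (1 - torus x 0 j * eta) (- tnth al j)).
Proof.
move=> e1; apply: ccvg_prod => j.
have er : Normc.normc (torus x 0 j * eta) = Normc.normc eta.
  by rewrite Normc.normcM normc_torus mul1r.
have [|e e0 He] := @binomial_series _ (tnth al j) (Normc.normc eta).
  by rewrite normc_ge0.
apply: (ccvg_normc e0) => n; rewrite cpow_rhpE.
  by apply: He; rewrite er.
by apply: Re_onem_gt0; rewrite er.
Qed.

Lemma integrable_cst_angles (c : R) : mu.-integrable angles (EFin \o (fun=> c)).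
Proof.
apply: (measurable_bounded_integrable (@measurable_angles R q)).
- by rewrite [X in (X < _)%E](@lebesgue_angles R q) ltry.
- exact: measurable_cst.
- by exists `|c|; split; [exact: num_real|move=> x cx y _ /=; exact: ltW].
Qed.

Let two_pi_neq0 : (2 * pi)%:C != 0 :> R[i].
Proof. by rewrite eq_complex /= eqxx andbT mulf_neq0// gt_eqF ?pi_gt0. Qed.

(** The sum is the mean of [torus_poly] over the torus and inherits its bound [M]; the factor 2
    comes from estimating both components. Uniformity in [eta] is what the integral over the
    hypercube requires. *)
Lemma diag_sum_bounded r : 0 <= r < 1 ->
  exists2 M, 0 <= M & forall eta N, Normc.normc eta <= r ->
    Normc.normc (\sum_(n < N) diag_coef n * (eta ^+ (q + 1)) ^+ n) <= M.
Proof.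
move=> r01; have [M M0 HM] := torus_poly_bounded r01.
exists (2 * M); first by rewrite mulr_ge0.
move=> eta N er.
have [h1 h2] := torus_poly_integral eta N; have [r1 i1] := h1.
have p0 : 0 < (2 * pi) ^+ q :> R by rewrite exprn_gt0// mulr_gt0 ?pi_gt0.
rewrite -(ler_pM2l p0).
have -> : (2 * pi) ^+ q * Normc.normc (\sum_(n < N) diag_coef n * (eta ^+ (q + 1)) ^+ n)
  = Normc.normc (cintegral mu angles (torus_poly eta N)).
  rewrite h2 Normc.normcM normcX normc_real ger0_norm// mulr_ge0// pi_ge0//.
have K (g : tup -> R) : mu.-integrable angles (EFin \o g) ->
    (forall x, `|g x| <= M) -> `| \int[mu]_(x in angles) g x| <= (2 * pi) ^+ q * M.
  move=> ig gM.
  apply: (le_trans (le_normr_Rintegral (@measurable_angles R q) ig)).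
  have -> : (2 * pi) ^+ q * M = \int[mu]_(x in angles) M.
    rewrite Rintegral_cst; last exact: measurable_angles.
    by rewrite [X in _ * fine X](@lebesgue_angles R q) mulrC.
  apply: le_Rintegral => //; [exact: measurable_angles|exact: integrable_norm|].
  exact: integrable_cst_angles.
apply: (le_trans (normc_le_ReIm _)).
rewrite mulrCA mulr2n mulrDl mul1r lerD//.
- apply: K => // x; apply: (le_trans (normc_Re _)); exact: HM.
- apply: K => // x; apply: (le_trans (normc_Im _)); exact: HM.
Qed.

Lemma Res_diag eta : Normc.normc eta < 1 ->
  Res_exists (omega eta) /\
  ccvg (fun N => \sum_(n < N.+1) diag_coef n * (eta ^+ (q + 1)) ^+ n) (Res (omega eta)).
Proof.
move=> e1.
have r01 : 0 <= Normc.normc eta < 1 by rewrite normc_ge0.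
have [M M0 HM] := torus_poly_bounded r01.
have mA := @measurable_angles R q.
have [h1 h2] := cdominated_convergence mA (fun N => (torus_poly_integral eta N.+1).1)
  (fun x _ => torus_poly_cvg x e1) (integrable_cst_angles M)
  (fun N x _ => HM eta N.+1 x (lexx _)).
have E : pullback (omega eta) = (fun x => 'i ^+ q *
    \prod_(j < q + 1) cpow (1 - torus x 0 j * eta) (- tnth al j)).
  apply/funext => x; rewrite /pullback /omega mulrC; congr (_ * _).
  exact: pullback_gelfand_leray.
split; first by rewrite /Res_exists E; apply: cintegrableZl.
(* The constant i^q of the pulled-back Gelfand-Leray form cancels the one in (2 pi i)^(-q). *)
rewrite /Res E cintegralZl// mulrA -exprMn invfM -mulrA mulVf ?mulr1; last first.
  by rewrite eq_complex /= oner_eq0 andbF.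
rewrite exprVn.
have -> : (fun N => \sum_(n < N.+1) diag_coef n * (eta ^+ (q + 1)) ^+ n) =
  (fun N => ((2 * pi)%:C ^+ q)^-1 * cintegral mu angles (torus_poly eta N.+1)).
  apply/funext => N; rewrite (torus_poly_integral _ _).2 mulKf//.
  by rewrite expf_neq0.
exact: ccvgM (ccvg_cst _) h2.
Qed.

End torus_expansion.

(** * Assembly of the hypergeometric series *)

Lemma pFq_term_beta (R : realType) (q n : nat) (alpha : (q + 1).-tuple R[i])
    (beta : q.-tuple R[i]) (t : R[i]) :
  (forall i : 'I_q, 1 < complex.Re (tnth beta i)) ->
  (\prod_(i < q) (tnth beta i - 1)) * (diag_coef alpha n * t ^+ n *
    \prod_(i < q) (n`!%:R / ((tnth beta i - 1) * pochhammer (tnth beta i) n))) =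
  pFq_term alpha beta t n.
Proof.
move=> hbeta; rewrite /pFq_term !big_tuple /diag_coef /binomial_coef.
have n0 : n`!%:R != 0 :> R[i] by rewrite pnatr_eq0 -lt0n fact_gt0.
have b0 i : tnth beta i - 1 != 0.
  by rewrite subr_eq0; apply: contraTneq (hbeta i) => ->; rewrite ltxx.
have -> : \prod_(i < q) (n`!%:R / ((tnth beta i - 1) * pochhammer (tnth beta i) n)) =
    n`!%:R ^+ q / ((\prod_(i < q) (tnth beta i - 1)) *
      \prod_(i < q) pochhammer (tnth beta i) n).
  by rewrite -big_split /= prodf_div prodr_const card_ord.
(* [diag_coef] carries n!^(-(q+1)) and the Beta integrals carry n!^q; the 1/n! that remains is the
   one of the hypergeometric term. *)
rewrite prodf_div prodr_const card_ord exprD expr1.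
have B0 : \prod_(i < q) (tnth beta i - 1) != 0 by apply/prodf_neq0 => i _.
move: (\prod_(i < q) (tnth beta i - 1)) B0 => B B0.
move: (\prod_(i < q) pochhammer _ _) (\prod_(i < q + 1) pochhammer _ _) => P A.
have nq : n`!%:R ^+ q != 0 :> R[i] by rewrite expf_neq0.
rewrite (invfM B); move: (P^-1) => P'.
by field; rewrite nq B0 n0.
Qed.

Lemma cvgn_pFq (R : realType) (a b : seq R[i]) (t l : R[i]) :
  ccvg (fun N => \sum_(n < N) pFq_term a b t n) l ->
  cvgn (pFq_series a b t) /\ pFq a b t = l.
Proof.
move=> h; have c : pFq_series a b t @ \oo --> (l : (R[i] : numFieldType)).
  rewrite (_ : pFq_series a b t = (fun N => \sum_(n < N) pFq_term a b t n)).
    exact: ccvg_cvg.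
  by apply/funext => N; rewrite /pFq_series /series /= big_mkord.
split; first by apply/cvg_ex; exists l.
exact: (cvg_lim (@norm_hausdorff _ _) c).
Qed.

(** [limn] and the integrals return a value even without convergence or integrability, so the first
    three conclusions are what gives the formula its meaning. [s] is the fixed choice of
    t^(1/(q+1)). *)
Theorem theorem1 (R : realType) (q : nat) (hq : (1 <= q)%N)
    (alpha : (q + 1).-tuple R[i]) (beta : q.-tuple R[i])
    (hbeta : forall i : 'I_q, 1 < complex.Re (tnth beta i))
    (t : R) (ht : `|t| < 1)
    (s : R[i]) (hs : s ^+ (q + 1) = t%:C) :
  let eta (tau : q.-tuple R) : R[i] :=
    ((\prod_(i < q) tnth tau i) `^ (q + 1)%:R^-1)%:C * s in
  let omega (tau : q.-tuple R) (a : 'rV[R[i]]_(q + 1))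
      (V : 'M[R[i]]_(q, q + 1)) : R[i] :=
    \prod_(j < q + 1) cpow (1 - a 0 j * eta tau) (- tnth alpha j)
    * gelfand_leray a V in
  let integrand (tau : q.-tuple (measurableTypeR R)) : R[i] :=
    \prod_(i < q) cpow (1 - tnth tau i)%:C (tnth beta i - 2)
    * Res (omega tau) in
  let C : R[i] := \prod_(i < q) (tnth beta i - 1) in
  [/\ cvgn (pFq_series alpha beta t%:C),
      forall tau, cube tau -> Res_exists (omega tau),
      cintegrable (lebesgue_tuple q) cube integrand &
      pFq alpha beta t%:C = C * cintegral (lebesgue_tuple q) cube integrand].
Proof.
move=> eta omega integrand C.
pose I : set (measurableTypeR R) := `]0%R, 1%R[%classic.
have mI : measurable I by exact: measurable_itv.
have cubeE : cube = [set x : q.-tuple (measurableTypeR R) | forall i, I (tnth x i)].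
  by apply/seteqP; split => x /= h k; move: (h k); rewrite /I /= in_itv.
have mC : measurable (@cube R q) by rewrite cubeE; exact: (measurable_box (A := fun=> I)).
have q0 : 0 < (q + 1)%:R :> R by rewrite addn1.
have s1 : Normc.normc s < 1.
  have : Normc.normc s ^+ (q + 1) < 1 by rewrite -normcX hs normc_real.
  by rewrite expr_lt1 ?addn1 ?normc_ge0.
have s01 : 0 <= Normc.normc s < 1 by rewrite normc_ge0.
have prod01 (tau : q.-tuple R) : cube tau -> 0 < \prod_(i < q) tnth tau i <= 1.
  move=> ctau; apply/andP; split.
    by apply: prodr_gt0 => i _; have /andP[] := ctau i.
  apply: prodr_ile1 => i _; have /andP[t0 t1] := ctau i.
  by rewrite !ltW.
(* The diagonal sums contain [eta] only through this power, in which the root [s] disappears and the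
   variables separate. *)
have etaX (tau : q.-tuple R) : cube tau ->
    eta tau ^+ (q + 1) = (\prod_(i < q) (tnth tau i)%:C) * t%:C.
  move=> /prod01/andP[p0 p1]; rewrite /eta exprMn hs -rmorphXn -rmorph_prod /=.
  by rewrite -powR_mulrn ?powR_ge0// -powRrM mulVf ?gt_eqF// powRr1// ltW.
have eta_s (tau : q.-tuple R) : cube tau -> Normc.normc (eta tau) <= Normc.normc s.
  move=> /prod01/andP[p0 p1]; rewrite Normc.normcM ler_piMl ?normc_ge0//.
  rewrite normc_real ger0_norm ?powR_ge0//.
  apply: (@le_trans _ _ (1 `^ (q + 1)%:R^-1)); last by rewrite powR1.
  by rewrite ge0_ler_powR// ?nnegrE ?invr_ge0 ?ltW.
have eta1 (tau : q.-tuple R) (ctau : cube tau) := le_lt_trans (eta_s tau ctau) s1.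
pose S N (tau : q.-tuple R) : R[i] :=
  \sum_(n < N) diag_coef alpha n * (eta tau ^+ (q + 1)) ^+ n.
pose W (tau : q.-tuple R) : R[i] :=
  \prod_(i < q) cpow (1 - tnth tau i)%:C (tnth beta i - 2).
have [M M0 HM] := diag_sum_bounded alpha s01.
pose wn n (i : 'I_q) (u : measurableTypeR R) : R[i] :=
  cpow (1 - u)%:C (tnth beta i - 2) * u%:C ^+ n.
have wi n i : cintegrable lebesgue_measure I (wn n i).
  by have [] := beta_integral n (hbeta i).
have wE n i : cintegral lebesgue_measure I (wn n i) =
    n`!%:R / ((tnth beta i - 1) * pochhammer (tnth beta i) n).
  by have [] := beta_integral n (hbeta i).
have Wn n := cintegral_box_prod (fun=> mI) (wi n).
rewrite -cubeE in Wn.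
have termE n (tau : q.-tuple R) : cube tau ->
    W tau * (diag_coef alpha n * (eta tau ^+ (q + 1)) ^+ n) =
    (diag_coef alpha n * t%:C ^+ n) * \prod_(i < q) wn n i (tnth tau i).
  move=> ctau; rewrite etaX// exprMn -prodrXl /wn big_split /= /W; ring.
have SE N (tau : q.-tuple R) : cube tau -> W tau * S N tau =
    \sum_(n < N) (diag_coef alpha n * t%:C ^+ n) * \prod_(i < q) wn n i (tnth tau i).
  by move=> ctau; rewrite mulr_sumr; apply: eq_bigr => n _; exact: termE.
have Si N : cintegrable (lebesgue_tuple q) cube (fun tau => W tau * S N tau).
  apply: (eq_cintegrable mC (fun x cx => esym (SE N x cx))).
  by apply: cintegrable_sum => // n; apply: cintegrableZl => //; exact: (Wn n).1.
have CS N : C * cintegral (lebesgue_tuple q) cube (fun tau => W tau * S N tau) =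
    \sum_(n < N) pFq_term alpha beta t%:C n.
  rewrite [X in C * X](eq_cintegral (lebesgue_tuple q) (SE N)) cintegral_sum//; last first.
    by move=> n; apply: cintegrableZl => //; exact: (Wn n).1.
  rewrite mulr_sumr; apply: eq_bigr => n _.
  rewrite cintegralZl//; last exact: (Wn n).1.
  by rewrite (Wn n).2 (eq_bigr _ (fun i _ => wE n i)) pFq_term_beta.
(* The weight alone is the case n = 0 of the Beta products. *)
have W_int : cintegrable (lebesgue_tuple q) cube W.
  apply: (eq_cintegrable mC _ (Wn 0%N).1) => tau _.
  by apply: eq_bigr => i _; rewrite /wn expr0 mulr1.
(* One constant [M] serves for the whole hypercube because |eta| <= |s| < 1 there. *)
have g_int := integrableZl mC M (cintegrable_normReIm mC W_int).
have [||h1 h2] := cdominated_convergence (f := integrand) mC (fun N => Si N.+1) _ g_int.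
- move=> tau ctau; apply: ccvgM; first exact: ccvg_cst.
  exact: (Res_diag alpha (eta1 tau ctau)).2.
- move=> N tau ctau; rewrite Normc.normcM mulrC; apply: ler_pM; rewrite ?normc_ge0//.
    by apply: HM; exact: eta_s.
  exact: normc_le_ReIm.
have h3 : ccvg (fun N => \sum_(n < N) pFq_term alpha beta t%:C n)
    (C * cintegral (lebesgue_tuple q) cube integrand).
  apply: ccvg_shiftS; under eq_fun do rewrite -CS.
  exact: ccvgM (ccvg_cst _) h2.
have [c1 c2] := cvgn_pFq h3.
split => // tau ctau; exact: (Res_diag alpha (eta1 tau ctau)).1.
Qed.
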